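(* For every integer $n\ge0$, all of the following hold: $$\overline N(0,6,n)+\overline N(1,6,n)\ge\overline N(2,6,n)+\overline N(3,6,n),$$ $$\overline N(0,6,3n)+\overline N(3,6,3n)\ge\overline N(1,6,3n)+\overline N(2,6,3n),$$ $$\overline N(0,6,3n+1)+\overline N(3,6,3n+1)\ge\overline N(1,6,3n+1)+\overline N(2,6,3n+1),$$ $$\overline N(0,6,3n+2)+\overline N(3,6,3n+2)\le\overline N(1,6,3n+2)+\overline N(2,6,3n+2),$$ $$\overline N(0,3,3n)\ge\overline N(1,3,3n)=\overline N(2,3,3n),$$ $$\overline N(0,3,3n+1)\ge\overline N(1,3,3n+1)=\overline N(2,3,3n+1),$$ $$\overline N(0,3,3n+2)\le\overline N(1,3,3n+2)=\overline N(2,3,3n+2).$$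
   Context: An overpartition of $n$ is a partition of $n$ in which the first occurrence of each part may be overlined. The rank of an overpartition is its largest part minus the number of its parts (the empty overpartition of $0$ has rank $0$). $\overline N(a,c,n)$ denotes the number of overpartitions of $n$ with rank congruent to $a$ modulo $c$. Equivalently, if $\overline N(m,n)$ is the number of overpartitions of $n$ with rank $m$, then $\sum_{n\ge0}\sum_{m\in\mathbb Z}\overline N(m,n)u^mq^n=\sum_{n\ge0}\frac{(-1)_nq^{n(n+1)/2}}{(uq)_n(q/u)_n}$, where $(x)_n=\prod_{r=0}^{n-1}(1-xq^r)$, and $\overline N(a,c,n)=\sum_{m\equiv a\ (\mathrm{mod}\ c)}\overline N(m,n)$. *)

(* Defs.v *)
From mathcomp Require Import all_boot all_order all_algebra.

Set Implicit Arguments.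
Unset Strict Implicit.
Unset Printing Implicit Defensive.

(* Each entry is a part together with a flag telling whether it is overlined. *)
Definition parts (s : seq (nat * bool)) : seq nat := unzip1 s.

(* The last condition says that an overlined entry differs in size from every
   earlier entry, i.e. it is the first occurrence of that part. *)
Definition overpartition (n : nat) (s : seq (nat * bool)) : bool :=
  [&& all (fun p => 0 < p) (parts s),
      sumn (parts s) == n,
      sorted geq (parts s)
    & pairwise (fun x y => y.2 ==> (x.1 != y.1)) s].

(* The maximum over the empty sequence is 0, so the empty overpartition has
   rank 0. *)
Definition rank (s : seq (nat * bool)) : int :=
  ((\max_(p <- parts s) p)%N%:Z - (size s)%:Z)%R.

(* An overpartition of n has at most n parts, each at most n; the finite type
   [opcode n] therefore codes all of them (lemma [overpartition_decode]). *)
Definition opcode (n : nat) : finType := n.-bseq ('I_n.+1 * bool)%type.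

Definition decode (n : nat) (t : opcode n) : seq (nat * bool) :=
  [seq (val x.1, x.2) | x <- (t : n.-bseq _)].

Definition Nbar (a c n : nat) : nat :=
  #|[set t : opcode n | overpartition n (decode t)
                      & (rank (decode t) == a %[mod c])%Z]|.

Lemma decode_inj n : injective (@decode n).
Proof.
move=> t u /inj_map tu; apply/val_inj/tu.
by move=> [i b] [j c] [] /val_inj -> ->.
Qed.

Lemma overpartition_decode n s :
  overpartition n s -> exists t : opcode n, decode t = s.
Proof.
case/and4P=> s_gt0 /eqP sum_s _ _.
have size_s : size s <= n.
  rewrite -sum_s; elim: s s_gt0 {sum_s} => //= x s IHs /andP[x0 /IHs le_s].
  exact: leq_add x0 le_s.
have part_s x : x \in s -> x.1 < n.+1.
  move=> xs; rewrite ltnS -sum_s.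
  elim: s xs {sum_s size_s s_gt0} => //= y s IHs.
  rewrite in_cons => /orP[/eqP->|/IHs xs]; first exact: leq_addr.
  exact: leq_trans xs (leq_addl _ _).
pose f (x : nat * bool) : 'I_n.+1 * bool := (inord x.1, x.2).
have size_t : size (map f s) <= n by rewrite size_map.
exists (Bseq size_t); rewrite /decode /= -map_comp -[RHS]map_id.
by apply/eq_in_map => -[p b] /part_s /= p_lt; rewrite inordK.
Qed.

(* Main.v *)
(* Let R3 and R6 be the generating functions of N(0,3,n) - N(1,3,n) and of
   N(0,6,n) + N(1,6,n) - N(2,6,n) - N(3,6,n), that is, the rank generating function
   at primitive cube and sixth roots of unity u; the symmetry m <-> -m of the rank
   reduces every claim to the sign of their coefficients.  With
   psi(q) = sum_(n >= 0) q^(n(n+1)/2) and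
   lambda(q) = sum_(n in Z) (-1)^n q^(3n^2+3n) / (1 - q^(2n+1)) one has
       (q^6)_oo R3 = psi(q)^2 - 3 q^2 lambda(q^3),
       (q^6)_oo R6 = psi(q)^2 + q^2 lambda(q^3).
   Since lambda(q)/(q^2)_oo (a mock theta function of order three) has nonnegative
   coefficients, R6 is nonnegative.  The exponents congruent to 0 and 1 modulo 3 in
   R3 involve psi(q)^2 only.  On the exponents 3n+2, psi(q)^2 contributes
   psi(q^3)^2 (in the variable q^3), and psi(q^3)^2/(q^2)_oo and lambda(q)/(q^2)_oo
   expand over the same nonnegative series with coefficients at most 2 in the first
   expansion and at least 1 in the second, hence 3 lambda wins.
   The rank generating function itself is computed from Pascal-type recurrences for
   overpartitions in a box; multiplied by phi(-q) it is a double sum, and the two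
   identities follow by linear changes of variables in triple sums, where every
   part that is odd under an involution preserving the exponent vanishes. *)
Require Import Defs.
From mathcomp Require Import all_boot.
From HB Require Import structures.
From mathcomp Require Import all_order all_algebra.
From mathcomp Require Import boolp.
From mathcomp Require Import zify ring.

Set Implicit Arguments.
Unset Strict Implicit.
Unset Printing Implicit Defensive.
Import Order.TTheory GRing.Theory Num.Theory.
Local Open Scope ring_scope.

(** * Formal power series *)

(** No infinite product is ever formed. Each one enters through its theta expansion and its inverse
    through sums of box counts, so that [overgf * phiN = 1] and [dil 6 partgf * euler6 = 1] come
    from recurrences. Likewise psi(q)^2 is needed in two shapes: the Lambert double sum that the
    triple sums produce, and a true square, on which signs and residues modulo 3 are visible. The
    bridge between them is Jacobi's series for (q)_oo^3, characterized by a functional equation.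
    Sums over several integers carry no order of summation: [is_gf] only asks that each exponent
    receive finitely many nonzero weights. An involution proves that a family sums to 0 only if the
    family is summable, which is why these arguments are accompanied by quadratic bounds on the
    indices. The cube and the sixth root of unity are treated together. After multiplication by
    phi(-q) both rank series are built from the same two Lambert series, the halves of one double
    sum according to the parity of an index. Evaluating each half once serves both roots. *)

Record fps := Fps { fcoef :> nat -> int }.

Lemma fpsP (f g : fps) : f =1 g -> f = g.
Proof. by case: f g => f [g] /= fg; congr Fps; apply/funext. Qed.

HB.instance Definition _ := gen_eqMixin fps.
HB.instance Definition _ := gen_choiceMixin fps.

Definition fadd (f g : fps) := Fps (fun n => f n + g n).
Definition fopp (f : fps) := Fps (fun n => - f n).
Definition fzero := Fps (fun=> 0).
Definition fone := Fps (fun n => (n == 0%N)%:R).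
Definition fmul (f g : fps) := Fps (fun n => \sum_(i < n.+1) f i * g (n - i)%N).

Fact faddA : associative fadd. Proof. by move=> f g h; apply: fpsP => n /=; ring. Qed.
Fact faddC : commutative fadd. Proof. by move=> f g; apply: fpsP => n /=; ring. Qed.
Fact fadd0 : left_id fzero fadd. Proof. by move=> f; apply: fpsP => n /=; ring. Qed.
Fact faddN : left_inverse fzero fopp fadd.
Proof. by move=> f; apply: fpsP => n /=; ring. Qed.
HB.instance Definition _ := GRing.isZmodule.Build fps faddA faddC fadd0 faddN.

Definition trunc n (f : fps) : {poly int} := \poly_(i < n.+1) f i.

Lemma coef_trunc n (f : fps) i : (i <= n)%N -> (trunc n f)`_i = f i.
Proof. by move=> le_in; rewrite coef_poly ltnS le_in. Qed.

(** Any truncation order beyond [n] gives the same coefficient, so associativity and commutativity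
    are inherited from polynomials. *)
Lemma fmul_trunc m n (f g : fps) : (n <= m)%N ->
  fmul f g n = (trunc m f * trunc m g)`_n.
Proof.
move=> le_nm; rewrite coefM; apply: eq_bigr => i _.
rewrite !coef_trunc //; first exact: leq_trans (leq_subr _ _) le_nm.
by apply: leq_trans le_nm; rewrite -ltnS.
Qed.

Fact fmulA : associative fmul.
Proof.
move=> f g h; apply: fpsP => n.
transitivity (trunc n f * (trunc n g * trunc n h))`_n.
  rewrite [RHS]coefM; apply: eq_bigr => i _; congr (_ * _).
    by rewrite coef_trunc // -ltnS.
  exact/fmul_trunc/leq_subr.
rewrite mulrA [LHS]coefM; apply: eq_bigr => i _; congr (_ * _).
  by apply/esym/fmul_trunc; rewrite -ltnS.
exact/coef_trunc/leq_subr.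
Qed.
Fact fmulC : commutative fmul.
Proof. by move=> f g; apply: fpsP => n; rewrite !(fmul_trunc _ _ (leqnn n)) mulrC. Qed.
Fact fmul1 : left_id fone fmul.
Proof.
move=> f; apply: fpsP => n /=; rewrite big_ord_recl /= mul1r subn0.
by rewrite big1 ?addr0 // => i _; rewrite mul0r.
Qed.
Fact fmulDl : left_distributive fmul fadd.
Proof.
move=> f g h; apply: fpsP => n /=; rewrite -big_split /=.
by apply: eq_bigr => i _; rewrite mulrDl.
Qed.
Fact fone_neq0 : fone != fzero.
Proof. by apply/eqP => /(congr1 (fun f : fps => f 0%N)). Qed.
HB.instance Definition _ :=
  GRing.Zmodule_isComNzRing.Build fps fmulA fmulC fmul1 fmulDl fone_neq0.

Arguments fcoef : simpl never.

Lemma fps0E n : (0 : fps) n = 0. Proof. by []. Qed.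
Lemma fps1E n : (1 : fps) n = (n == 0%N)%:R. Proof. by []. Qed.
Lemma fpsDE (f g : fps) n : (f + g) n = f n + g n. Proof. by []. Qed.
Lemma fpsNE (f : fps) n : (- f) n = - f n. Proof. by []. Qed.
Lemma fpsBE (f g : fps) n : (f - g) n = f n - g n. Proof. by []. Qed.
Lemma fpsME (f g : fps) n : (f * g) n = \sum_(i < n.+1) f i * g (n - i)%N.
Proof. by []. Qed.
Lemma fps_sumE I r (P : pred I) (F : I -> fps) n :
  (\sum_(i <- r | P i) F i) n = \sum_(i <- r | P i) F i n.
Proof. exact: (big_morph (fun f : fps => f n)). Qed.

Definition q : fps := Fps (fun n => (n == 1%N)%:R).

Lemma fps_qE n : q n = (n == 1%N)%:R. Proof. by []. Qed.

Lemma fps_qM (f : fps) n : (q * f) n = if n is n'.+1 then f n' else 0.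
Proof.
rewrite fpsME; case: n => [|n]; first by rewrite big_ord1 fps_qE mul0r.
rewrite !big_ord_recl !fps_qE mul0r add0r mul1r subSS subn0 big1 ?addr0 //.
by move=> i _; rewrite fps_qE mul0r.
Qed.

Lemma fps_qXM k (f : fps) n : (q ^+ k * f) n = if (k <= n)%N then f (n - k)%N else 0.
Proof.
elim: k n => [|k IHk] n; first by rewrite mul1r subn0.
rewrite exprS -mulrA fps_qM; case: n => [|n] //=.
Qed.

Lemma fps_intE (c : int) (f : fps) n : (c%:~R * f) n = c * f n.
Proof.
rewrite mulrzl; elim/int_ind: c => [|m IHm|m IHm]; first by rewrite mul0r.
  by rewrite intS mulrzDr mulr1z fpsDE IHm mulrDl mul1r.
by rewrite intS opprD mulrzDr mulrN1z fpsDE IHm fpsNE mulrDl mulN1r.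
Qed.

(** * Generating functions of weighted families *)

(** A relation rather than an operator: it carries the finiteness of the support, and by
    [is_sum_seq] the value does not depend on the list. *)
Definition is_sum (I : eqType) (f : I -> int) (s : int) : Prop :=
  exists2 r : seq I, uniq r /\ (forall i, f i != 0 -> i \in r) &
    s = \sum_(i <- r) f i.

Section IsSum.
Variable I : eqType.
Implicit Types (f g : I -> int) (s t : int) (r : seq I).

Lemma is_sum_seq f s r : is_sum f s -> uniq r ->
  (forall i, f i != 0 -> i \in r) -> s = \sum_(i <- r) f i.
Proof.
have supp r' : \sum_(i <- r') f i = \sum_(i <- [seq i <- r' | f i != 0]) f i.
  rewrite big_filter [RHS]big_mkcond; apply: eq_bigr => i _.
  by case: eqP.
case=> r' [ur' fr'] -> ur fr; rewrite supp [RHS]supp.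
apply/perm_big/uniq_perm; rewrite ?filter_uniq // => i.
by rewrite !mem_filter; case: eqP => //= /eqP fi; rewrite fr ?fr'.
Qed.

Lemma is_sum_uniq f s t : is_sum f s -> is_sum f t -> s = t.
Proof. by move=> fs [r [ur fr] ->]; apply: is_sum_seq. Qed.

Lemma eq_is_sum f g s : f =1 g -> is_sum f s -> is_sum g s.
Proof. by move=> /funext ->. Qed.

Lemma is_sum_ex f r : (forall i, f i != 0 -> i \in r) -> exists s, is_sum f s.
Proof.
move=> fr; exists (\sum_(i <- undup r) f i), (undup r) => //.
by split=> [|i /fr]; rewrite ?undup_uniq ?mem_undup.
Qed.

Lemma is_sum0 f : (forall i, f i = 0) -> is_sum f 0.
Proof.
move=> f0; exists [::]; rewrite ?big_nil //; split=> // i.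
by rewrite f0 eqxx.
Qed.

Lemma is_sumD f g s t : is_sum f s -> is_sum g t ->
  is_sum (fun i => f i + g i) (s + t).
Proof.
move=> fs gt; have [r [_ fr] _] := fs; have [r' [_ gr'] _] := gt.
pose u := undup (r ++ r').
have uP i : i \in u = (i \in r) || (i \in r') by rewrite mem_undup mem_cat.
exists u; first split=> [|i]; first exact: undup_uniq.
  apply: contraR; rewrite uP negb_or => /andP[nr nr'].
  by rewrite (contraNeq (fr i) nr) (contraNeq (gr' i) nr').
rewrite big_split; congr (_ + _).
  by apply: is_sum_seq fs _ _ => [|i /fr]; rewrite ?undup_uniq // uP => ->.
by apply: is_sum_seq gt _ _ => [|i /gr']; rewrite ?undup_uniq // uP => ->;
  rewrite orbT.
Qed.

Lemma is_sumZ c f s : is_sum f s -> is_sum (fun i => c * f i) (c * s).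
Proof.
case=> r [ur fr] ->; exists r; last by rewrite mulr_sumr.
by split=> // i; rewrite mulf_eq0 negb_or => /andP[_ /fr].
Qed.

Lemma is_sum_big (K : Type) (z : seq K) (f : K -> I -> int) (s : K -> int) :
  (forall k, is_sum (f k) (s k)) ->
  is_sum (fun i => \sum_(k <- z) f k i) (\sum_(k <- z) s k).
Proof.
move=> fs; elim: z => [|k z IHz].
  by rewrite big_nil; apply: is_sum0 => i; rewrite big_nil.
rewrite big_cons; apply: eq_is_sum (is_sumD (fs k) IHz) => i.
by rewrite big_cons.
Qed.

End IsSum.

(** The map [h] is only an injection whose image covers the support. This allows reparametrizing a
    family that lives on a sublattice, such as the pairs with even sum. *)
Lemma is_sum_bij (I J : eqType) (f : I -> int) s (h : J -> I) (g : I -> J) :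
  cancel h g -> (forall i, f i != 0 -> h (g i) = i) ->
  is_sum f s <-> is_sum (fun j => f (h j)) s.
Proof.
move=> hK gK; split=> -[r [ur fr] ->].
- have sub_r : \sum_(i <- r) f i = \sum_(i <- [seq i <- r | h (g i) == i]) f i.
    rewrite big_filter [RHS]big_mkcond; apply: eq_bigr => i _.
    by case: eqP => // /eqP; apply: contraNeq => /gK->.
  exists [seq g i | i <- r & h (g i) == i].
    split=> [|j /fr hj].
      rewrite map_inj_in_uniq ?filter_uniq // => i j.
      by rewrite !mem_filter => /andP[/eqP<- _] /andP[/eqP<- _]; rewrite !hK => ->.
    by rewrite -(hK j); apply: map_f; rewrite mem_filter hK eqxx.
  rewrite sub_r big_map; apply: eq_big_seq => i.
  by rewrite mem_filter => /andP[/eqP-> _].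
- exists (map h r); last by rewrite big_map.
  split=> [|i fi]; first by rewrite map_inj_uniq //; apply: can_inj hK.
  by rewrite -(gK i fi); apply/map_f/fr; rewrite gK.
Qed.

Lemma is_sumM (I J : eqType) (f : I -> int) (g : J -> int) s t :
  is_sum f s -> is_sum g t -> is_sum (fun p => f p.1 * g p.2) (s * t).
Proof.
case=> r [ur fr] -> [r' [ur' gr']] ->.
exists [seq (i, j) | i <- r, j <- r'].
  split=> [|[i j] /=]; first by rewrite allpairs_uniq // => -[? ?] [? ?].
  by rewrite mulf_eq0 negb_or => /andP[/fr ri /gr' rj]; apply/allpairsP; exists (i, j).
rewrite big_allpairs_dep mulr_suml; apply: eq_bigr => i _.
by rewrite mulr_sumr.
Qed.

Lemma is_sum_fold (I J : eqType) (f : I * J -> int) s (c : J -> int) :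
  is_sum f s -> (forall j, is_sum (fun i => f (i, j)) (c j)) -> is_sum c s.
Proof.
case=> r [ur fr] -> fc; pose u := undup (map fst r); pose v := undup (map snd r).
have fu i j : f (i, j) != 0 -> i \in u.
  by move=> /fr /(map_f fst); rewrite mem_undup.
have fv i j : f (i, j) != 0 -> j \in v.
  by move=> /fr /(map_f snd); rewrite mem_undup.
have cE j : c j = \sum_(i <- u) f (i, j).
  by apply: is_sum_seq (fc j) _ _; rewrite ?undup_uniq // => i; apply: fu.
exists v.
  split=> [|j]; first exact: undup_uniq.
  apply: contraR => vj; rewrite cE big1 // => i _.
  by apply: contraNeq vj; apply: fv.
have -> : \sum_(i <- r) f i = \sum_(p <- [seq (i, j) | i <- u, j <- v]) f p.
  apply: (is_sum_seq (I := (I * J)%type)); first by exists r.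
    by rewrite allpairs_uniq ?undup_uniq // => -[? ?] [? ?].
  by move=> [i j] fij; apply/allpairsP; exists (i, j); rewrite /= (fu i j) // (fv i j).
rewrite big_allpairs_dep exchange_big /=; apply: eq_bigr => j _; exact/esym/cE.
Qed.

(* [s] is the sum of [w i * q ^ e i] over all [i]; each exponent receives finitely
   many nonzero weights, and the terms of negative exponent are dropped. *)
Definition is_gf (I : eqType) (w e : I -> int) (s : fps) : Prop :=
  forall M : nat, is_sum (fun i => if e i == M%:Z then w i else 0) (s M).

Section GeneratingFunction.
Variable I : eqType.
Implicit Types (w e : I -> int) (s t : fps).

Lemma gf_uniq w e s t : is_gf w e s -> is_gf w e t -> s = t.
Proof. by move=> ws wt; apply: fpsP => M; apply: is_sum_uniq (ws M) (wt M). Qed.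

Lemma eq_is_gf w w' e e' s : w =1 w' -> (forall i, w i != 0 -> e i = e' i) ->
  is_gf w e s -> is_gf w' e' s.
Proof.
move=> ww' ee' ws M; apply: eq_is_sum (ws M) => i; rewrite -ww'.
by have [->|/ee'->] := eqVneq (w i) 0; rewrite ?if_same.
Qed.

Lemma gf_ex w e :
  (forall M : nat, exists r : seq I, forall i, w i != 0 -> e i = M%:Z -> i \in r) ->
  exists s, is_gf w e s.
Proof.
move=> fin; suff /choice[s ws] : forall M : nat,
    exists s : int, is_sum (fun i => if e i == M%:Z then w i else 0) s.
  by exists (Fps s).
move=> M; have [r wr] := fin M; apply: (is_sum_ex (r := r)) => i.
by case: (e i =P M%:Z) => // eM wi; apply: wr.
Qed.

Lemma gfD w w' e s t : is_gf w e s -> is_gf w' e t ->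
  is_gf (fun i => w i + w' i) e (s + t).
Proof.
move=> ws wt M; apply: eq_is_sum (is_sumD (ws M) (wt M)) => i.
by case: eqP => // _; rewrite addr0.
Qed.

Lemma gfZ (c : int) w e s : is_gf w e s -> is_gf (fun i => c * w i) e (c%:~R * s).
Proof.
move=> ws M; rewrite fps_intE.
by apply: eq_is_sum (is_sumZ c (ws M)) => i; case: eqP; rewrite ?mulr0.
Qed.

Lemma gf_odd w e s (h : I -> I) : involutive h ->
  (forall i, w i != 0 -> e (h i) = e i) -> (forall i, w (h i) = - w i) ->
  is_gf w e s -> s = 0.
Proof.
move=> hK eh wh ws; apply: fpsP => M; have := ws M.
rewrite fps0E (is_sum_bij _ hK) => [wh'|i _]; last exact: hK.
suff : s M = - s M by lia.
apply: is_sum_uniq wh' _; rewrite -mulN1r; apply: eq_is_sum (is_sumZ (-1) (ws M)) => i.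
rewrite wh; have [->|/eh->] := eqVneq (w i) 0; first by rewrite !if_same; ring.
by case: eqP; rewrite ?mulN1r ?oppr0.
Qed.

(** Since [is_gf] drops the terms of negative exponent, a shift could bring some of them back; the
    condition on [e] excludes this, here and in [gfM]. *)
Lemma gf_shift k w e s : is_gf w e s -> (forall i, w i != 0 -> 0 <= e i) ->
  is_gf w (fun i => e i + k%:Z) (q ^+ k * s).
Proof.
move=> ws e0 M; rewrite fps_qXM; case: leqP => [kM|Mk].
  apply: eq_is_sum (ws (M - k)%N) => i; rewrite -subzn //.
  by congr (if _ then _ else _); lia.
apply: is_sum0 => i; case: eqP => // eiM.
by apply/eqP; apply: contraT => /e0; lia.
Qed.

Lemma gf_ge0 w e s : (forall i, 0 <= w i) -> is_gf w e s -> forall M, 0 <= s M.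
Proof.
move=> w0 ws M; have [r _ ->] := ws M.
by apply: sumr_ge0 => i _; case: ifP.
Qed.

End GeneratingFunction.

Lemma gf_bij (I J : eqType) (w e : I -> int) s (h : J -> I) (g : I -> J) :
  cancel h g -> (forall i, w i != 0 -> h (g i) = i) ->
  is_gf w e s <-> is_gf (fun j => w (h j)) (fun j => e (h j)) s.
Proof.
move=> hK gK; have supp (M : nat) i : (if e i == M%:Z then w i else 0) != 0 -> h (g i) = i.
  by case: (e i =P M%:Z) => // _ /gK.
split=> ws M; first exact/(is_sum_bij _ hK (supp M)).
by apply/(is_sum_bij _ hK (supp M)).
Qed.

(** The exponent ignores the first component, which can therefore be summed out. Applied to
    [signed_range], this turns a double sum into a theta series with linear weight. *)
Lemma gf_fold (I J : eqType) (w : I * J -> int) (e c : J -> int) s :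
  is_gf w (fun p => e p.2) s -> (forall j, is_sum (fun i => w (i, j)) (c j)) -> is_gf c e s.
Proof.
move=> ws wc M; apply: is_sum_fold (ws M) _ => j /=.
by case: eqP => // _; apply: is_sum0.
Qed.

Lemma gfM (I J : eqType) (w e : I -> int) (w' e' : J -> int) s t :
  is_gf w e s -> is_gf w' e' t ->
  (forall i, w i != 0 -> 0 <= e i) -> (forall j, w' j != 0 -> 0 <= e' j) ->
  is_gf (fun p => w p.1 * w' p.2) (fun p => e p.1 + e' p.2) (s * t).
Proof.
move=> ws wt e0 e0' M; rewrite fpsME -(big_mkord xpredT (fun i => s i * t (M - i)%N)).
apply: eq_is_sum (is_sum_big _ (fun k => is_sumM (ws k) (wt (M - k)%N))) => -[i j] /=.
have [->|/e0 ei0] := eqVneq (w i) 0.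
  by rewrite mul0r if_same big1 // => k _; rewrite if_same mul0r.
have [->|/e0' ej0] := eqVneq (w' j) 0.
  by rewrite mulr0 if_same big1 // => k _; rewrite if_same mulr0.
case: eqP => [eM|neM].
  (* Among the splittings of [M] into [k] and [M - k], only [k = e i] sees the pair. *)
  rewrite (bigD1_seq `|e i|%N) ?iota_uniq ?mem_index_iota //=; last by lia.
  rewrite gez0_abs // eqxx ifT; last by lia.
  by rewrite big1 ?addr0 // => k /eqP nk; rewrite ifF ?mul0r //; lia.
rewrite big_nat big1 // => k kM; case: (e i =P _) => [ek|]; rewrite ?mul0r //.
by case: (e' j =P _) => [ek'|]; rewrite ?mulr0 //; case: neM; lia.
Qed.

Definition box (K : nat) : seq int := [seq k%:Z - K%:Z | k <- iota 0 K.*2.+1].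

Lemma mem_box K (a : int) : `|a| <= K%:Z -> a \in box K.
Proof.
move=> aK; apply/mapP; exists (absz (a + K%:Z)); last by lia.
by rewrite mem_iota; lia.
Qed.

Lemma gf_ex1 (w e : int -> int) :
  (forall M : nat, exists K : nat, forall a, w a != 0 -> e a = M%:Z -> `|a| <= K%:Z) ->
  exists s, is_gf w e s.
Proof.
move=> fin; apply: gf_ex => M; have [K wK] := fin M.
by exists (box K) => a wa /(wK _ wa)/mem_box.
Qed.

Lemma gf_ex2 (w e : int * int -> int) :
  (forall M : nat, exists K : nat, forall a b, w (a, b) != 0 -> e (a, b) = M%:Z ->
     `|a| + `|b| <= K%:Z) ->
  exists s, is_gf w e s.
Proof.
move=> fin; apply: gf_ex => M; have [K wK] := fin M.
exists [seq (a, b) | a <- box K, b <- box K] => -[a b] wab /(wK _ _ wab) abK.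
by apply/allpairsP; exists (a, b); split=> //; apply: mem_box => /=; lia.
Qed.

Lemma gf_ex3 (w e : int * (int * int) -> int) :
  (forall M : nat, exists K : nat, forall a b c,
     w (a, (b, c)) != 0 -> e (a, (b, c)) = M%:Z ->
     `|a| + `|b| + `|c| <= K%:Z) ->
  exists s, is_gf w e s.
Proof.
move=> fin; apply: gf_ex => M; have [K wK] := fin M.
exists [seq (a, p) | a <- box K, p <- [seq (b, c) | b <- box K, c <- box K]].
move=> [a [b c]] wab /(wK _ _ _ wab) abcK.
apply/allpairsP; exists (a, (b, c)); split=> //; first by apply: mem_box => /=; lia.
by apply/allpairsP; exists (b, c); split=> //; apply: mem_box => /=; lia.
Qed.

Lemma gf_reindex (I J : eqType) (w e : I -> int) (w' e' : J -> int) s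
    (h : J -> I) (g : I -> J) :
  is_gf w e s -> cancel h g -> (forall i, w i != 0 -> h (g i) = i) ->
  (forall j, w (h j) = w' j) -> (forall j, w' j != 0 -> e (h j) = e' j) -> is_gf w' e' s.
Proof.
move=> ws hK gK ww' ee'; have wh := iffLR (gf_bij _ s hK gK) ws.
by apply: eq_is_gf wh => // j; rewrite ww'; apply: ee'.
Qed.

Lemma gf_zero (I : eqType) (w e : I -> int) (h : I -> I) :
  (exists s, is_gf w e s) -> involutive h ->
  (forall i, w i != 0 -> e (h i) = e i) -> (forall i, w (h i) = - w i) -> is_gf w e 0.
Proof. by case=> s ws hK eh wh; rewrite -(gf_odd hK eh wh ws). Qed.

(** * Indefinite theta series *)

(** Signs and characteristic functions are integers built from residues and casts, so that case
    analyses on the weights fall to [lia]. *)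
Definition indic (b : bool) : int := (nat_of_bool b)%:Z.
Definition m1pow (n : int) : int := 1 - 2 * (n %% 2)%Z.

Lemma m1powD a b : m1pow (a + b) = m1pow a * m1pow b.
Proof.
rewrite /m1pow; have [] : (a %% 2)%Z = 0 \/ (a %% 2)%Z = 1 by lia.
  by move=> a0; rewrite a0; lia.
by move=> a1; rewrite a1; lia.
Qed.

Lemma m1powN a : m1pow (- a) = m1pow a. Proof. rewrite /m1pow; lia. Qed.
Lemma m1powS a : m1pow (a + 1) = - m1pow a. Proof. rewrite /m1pow; lia. Qed.

Lemma indic_neq0 x b : x * indic b != 0 -> b.
Proof. by case: b; rewrite ?mulr0. Qed.

Lemma indicB_neq0 x b c : x * (indic b - indic c) != 0 -> b || c.
Proof. by case: b; case: c; rewrite ?subrr ?mulr0. Qed.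

(** The oriented interval from 0 to [K]: its total weight is [K] for either sign of [K]. *)
Definition signed_range (K m : int) : int := indic (0 <= m < K) - indic (K <= m < 0).

Lemma is_sum_signed_range (K : int) : is_sum (signed_range K) K.
Proof.
case: K => K.
  exists [seq i%:Z | i <- iota 0 K].
    split=> [|i]; first by rewrite map_inj_uniq ?iota_uniq // => i j [].
    rewrite /signed_range /indic => i0; apply/mapP; exists (absz i); last by lia.
    by rewrite mem_iota; lia.
  rewrite big_map big_seq (eq_bigr (fun=> 1)) => [|i].
    by rewrite -big_seq big_const_seq count_predT size_iota iter_addr_0; lia.
  by rewrite mem_iota /signed_range /indic; lia.
exists [seq - (i.+1)%:Z | i <- iota 0 K.+1].
  split=> [|i]; first by rewrite map_inj_uniq ?iota_uniq // => i j; lia.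
  rewrite /signed_range /indic => i0; apply/mapP; exists (absz i).-1; last by lia.
  by rewrite mem_iota; lia.
rewrite big_map big_seq (eq_bigr (fun=> -1)) => [|i].
  by rewrite -big_seq big_const_seq count_predT size_iota iter_addr_0; lia.
by rewrite mem_iota /signed_range /indic; lia.
Qed.

(* [gf w e] is 0 when the weights are not summable. *)
Definition gf (I : eqType) (w e : I -> int) : fps :=
  if pselect (exists s, is_gf w e s) is left P then projT1 (cid P) else 0.

Lemma gf_spec (I : eqType) (w e : I -> int) :
  (exists s, is_gf w e s) -> is_gf w e (gf w e).
Proof. by rewrite /gf; case: pselect => // P _; case: cid. Qed.

(* [1 / (1 - q ^ c)] is the sum of [q ^ (b * c)] over [b >= 0] if [c > 0], and minus
   the sum over [b < 0] if [c < 0]; [eps], [eps1] and [eps2] are the signs by which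
   bilateral Lambert series become double sums. *)
Definition eps (a b : int) : int := indic ((0 <= a) && (0 <= b)) - indic ((a < 0) && (b < 0)).

Lemma sqr_bound (a : int) : 0 <= a * a /\ `|a| <= a * a.
Proof. split; nia. Qed.

Lemma sqrB_bound (a : int) : 0 <= a * a - a /\ `|a| <= a * a - a + 1.
Proof. split; nia. Qed.

Lemma sqrD_bound (a : int) : 0 <= a * a + a /\ `|a| <= a * a + a + 1.
Proof. split; nia. Qed.

Lemma mul_bound (b c : int) : 0 < b * c -> `|b| <= b * c /\ `|c| <= b * c.
Proof.
move=> bc0; have bcE : b * c = `|b| * `|c| by rewrite -normrM gtr0_norm.
move: bc0 (normr_ge0 b) (normr_ge0 c); rewrite bcE.
move: `|b| `|c| => x y xy x0 y0.
have x1 : 1 <= x by rewrite -gtz0_ge1 lt_neqAle x0 andbT; apply: contraTneq xy => <-;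
  rewrite mul0r.
have y1 : 1 <= y by rewrite -gtz0_ge1 lt_neqAle y0 andbT; apply: contraTneq xy => <-;
  rewrite mulr0.
by rewrite ler_peMr // ler_peMl.
Qed.

Lemma sgn_mul_gt0 (b c : int) : (0 < b) && (0 < c) || (b < 0) && (c < 0) -> 0 < b * c.
Proof. by case/orP => /andP[]; nia. Qed.

Lemma mul_boundr (b c : int) :
  (0 < c) && (0 <= b) || (c < 0) && (b <= 0) -> `|b| <= b * c.
Proof.
have [->|b0] := eqVneq b 0; first by rewrite mul0r normr0.
by move=> h; have [] // := mul_bound (b := b) (c := c) _; apply: sgn_mul_gt0; lia.
Qed.

(* phi(-q) in Ramanujan's notation. *)
Definition phiN := gf m1pow (fun n => n * n).
Lemma gf_phiN : is_gf m1pow (fun n => n * n) phiN.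
Proof. by apply/gf_spec/gf_ex1 => M; exists M => a _; nia. Qed.

(* (q^2)_oo^3, in the form given by Jacobi's identity. *)
Definition euler_cube_q2 := gf (fun i => m1pow i * i) (fun i => i * i + i).
Lemma gf_euler_cube_q2 : is_gf (fun i => m1pow i * i) (fun i => i * i + i) euler_cube_q2.
Proof. by apply/gf_spec/gf_ex1 => M; exists M.+1 => a _; nia. Qed.

(* Equal to psi(q)^2, by [Psi_sqr] below. *)
Definition psi_sq := gf (fun p => m1pow p.1 * eps p.1 p.2)
  (fun p => p.1 * p.1 + p.1 + (2 * p.1 + 1) * p.2).
Lemma gf_psi_sq : is_gf (fun p => m1pow p.1 * eps p.1 p.2)
  (fun p => p.1 * p.1 + p.1 + (2 * p.1 + 1) * p.2) psi_sq.
Proof.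
apply/gf_spec/gf_ex2 => M; exists M.+1 => a b /indicB_neq0 /=.
move=> h1 h2; have := sqrD_bound a.
have : `|b| <= b * (2 * a + 1) by apply: mul_boundr; lia.
by rewrite mulrC; move: ((2 * a + 1) * b) (a * a) h2 => x y; lia.
Qed.

(* The exponent [e] below is invariant under [a -> 1 - a], so that the quadrants where
   the weight does not otherwise depend on [a] cancel; what survives lives on [c = 0],
   where summation over [b] produces the linear weight of [euler_cube_q2].
   [euler6_lambert_even] and [euler6_lambert_odd] are proved in the same way. *)
Lemma phiN_psi_sq : phiN * psi_sq = euler_cube_q2.
Proof.
pose T := (int * (int * int))%type.
pose e (p : T) := p.1 * p.1 - p.1 + (2 * p.2.1 + 1) * p.2.2.
have gfA : is_gf (fun p : T => m1pow p.1 * eps p.2.1 (p.2.2 - p.2.1 - p.1)) e (phiN * psi_sq).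
  have := gfM gf_phiN gf_psi_sq.
  have e1 (i : int) : m1pow i != 0 -> 0 <= i * i by nia.
  have e2 (p : int * int) : m1pow p.1 * eps p.1 p.2 != 0 ->
      0 <= p.1 * p.1 + p.1 + (2 * p.1 + 1) * p.2.
    by move=> /indicB_neq0; nia.
  move=> /(_ e1 e2) gfA0.
  apply: (gf_reindex (h := fun p : T => (p.1 + p.2.1, (p.2.1, p.2.2 - p.2.1 - p.1)))
    (g := fun p : T => (p.1 - p.2.1, (p.2.1, p.2.2 + p.1))) gfA0).
  - by move=> [a [b c]] /=; congr (_, (_, _)); ring.
  - by move=> [a [b c]] _ /=; congr (_, (_, _)); ring.
  - by move=> [a [b c]] /=; rewrite mulrA -m1powD; congr (_ * _); rewrite /m1pow; lia.
  - by move=> [a [b c]] _; rewrite /e /=; ring.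
have gfP : is_gf (fun p : T => m1pow p.1 * indic ((0 <= p.2.1) && (0 < p.2.2))) e 0.
  apply: (gf_zero (h := fun p : T => (1 - p.1, p.2))).
  - apply: gf_ex3 => M; exists (8 * M + 8)%N => a b c /indic_neq0 /=; rewrite /e /=.
    move=> h1 h2; have := sqrB_bound a.
    have /mul_bound : 0 < (2 * b + 1) * c by apply: sgn_mul_gt0; lia.
    by move: ((2 * b + 1) * c) (a * a) h2 => x y h2; lia.
  - by move=> [a [b c]] /=; congr (_, _); ring.
  - by move=> [a [b c]] _; rewrite /e /=; ring.
  - by move=> [a [b c]] /=; rewrite -mulNr; congr (_ * _); rewrite /m1pow; lia.
have gfN : is_gf (fun p : T => m1pow p.1 * indic ((p.2.1 < 0) && (p.2.2 < 0))) e 0.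
  apply: (gf_zero (h := fun p : T => (1 - p.1, p.2))).
  - apply: gf_ex3 => M; exists (8 * M + 8)%N => a b c /indic_neq0 /=; rewrite /e /=.
    move=> h1 h2; have := sqrB_bound a.
    have /mul_bound : 0 < (2 * b + 1) * c by apply: sgn_mul_gt0; lia.
    by move: ((2 * b + 1) * c) (a * a) h2 => x y h2; lia.
  - by move=> [a [b c]] /=; congr (_, _); ring.
  - by move=> [a [b c]] _; rewrite /e /=; ring.
  - by move=> [a [b c]] /=; rewrite -mulNr; congr (_ * _); rewrite /m1pow; lia.
(* For nonzero [c], the weight [eps b (c - b - a)] has the slanted boundary [a + b = c], and [k] is
   what separates it from the quadrants bounded by [b = 0]. It depends on [a] and [b] through
   [a + b] only, so shifting [a] by [c] makes this family odd as well. *)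
pose k (n x : int) := indic ((n < 0) && (x <= 0)) - indic ((0 < n) && (0 < x)).
have gfK : is_gf (fun p : T => m1pow p.1 * k p.2.2 (p.1 + p.2.1 - p.2.2)) e 0.
  have gfK0 : is_gf (fun p : T => m1pow p.1 * m1pow p.2.2 * k p.2.2 p.2.1)
    (fun p : T => p.1 * p.1 - p.1 + p.2.2 * p.2.2 + 2 * p.2.1 * p.2.2) 0.
    apply: (gf_zero (h := fun p : T => (1 - p.1, p.2))).
    - apply: gf_ex3 => M; exists (8 * M + 8)%N => a b c /indicB_neq0 /=.
      move=> h1 h2; have := sqrB_bound a; have := sqr_bound c.
      have : `|b| <= b * c by apply: mul_boundr; lia.
      by move: h2; rewrite -mulrA; move: (b * c) (a * a) (c * c) => x y z; lia.
    - by move=> [a [b c]] /=; congr (_, _); ring.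
    - by move=> [a [b c]] _; rewrite /=; ring.
    - by move=> [a [b c]] /=; rewrite -!mulNr; congr (_ * _ * _); rewrite /m1pow; lia.
  apply: (gf_reindex (h := fun p : T => (p.1 - p.2.2, (p.1 + p.2.1 - p.2.2, p.2.2)))
    (g := fun p : T => (p.1 + p.2.2, (p.2.1 - p.1, p.2.2))) gfK0).
  - by move=> [a [b c]] /=; congr (_, (_, _)); ring.
  - by move=> [a [b c]] _ /=; congr (_, (_, _)); ring.
  - by move=> [a [b c]] /=; rewrite -m1powD; congr (m1pow _ * _); ring.
  - by move=> [a [b c]] _; rewrite /e /=; ring.
have := gfD gfA (gfD (gfZ (-1) gfP) (gfD gfN (gfZ (-1) gfK))).
rewrite !mulr0 !addr0 => gf4.
apply/esym/(gf_uniq gf_euler_cube_q2).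
have {gf4} : is_gf (fun p : int * int => m1pow p.2 * signed_range (1 - p.2) p.1)
    (fun p => p.2 * p.2 - p.2) (phiN * psi_sq).
  apply: (gf_reindex (h := fun p : int * int => (p.2, (p.1, 0)))
    (g := fun p : T => (p.2.1, p.1)) gf4).
  - by case.
  - move=> [a [b c]] /=; rewrite !mulN1r -!mulrN -!mulrDr mulf_eq0 negb_or.
    move=> /andP[_] h; congr (_, (_, _)); move: h; rewrite /eps /k /indic; lia.
  - move=> [a b] /=; rewrite !mulN1r -!mulrN -!mulrDr; congr (_ * _).
    by rewrite /eps /k /indic /signed_range /indic; lia.
  - by move=> [a b] _; rewrite /e /=; ring.
move=> /(gf_fold (c := fun i => m1pow i * (1 - i)) (e := fun i => i * i - i)) gf1.
have {}gf1 := gf1 (fun j => is_sumZ (m1pow j) (is_sum_signed_range (1 - j))).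
apply: (gf_reindex (h := fun i : int => i + 1) (g := fun i => i - 1) gf1).
- by move=> i; ring.
- by move=> i _; ring.
- by move=> i; rewrite m1powS; ring.
- by move=> i _; ring.
Qed.

(** * Lambert series twisted by the nonprincipal character modulo 3 *)

Definition chi3 (e : int) : int := indic ((e %% 3)%Z == 1) - indic ((e %% 3)%Z == 2).
Definition eps1 (a b : int) : int := indic ((0 < a) && (0 < b)) - indic ((a < 0) && (b < 0)).

(* (q^6)_oo, in the form given by the pentagonal number theorem. *)
Definition euler6 := gf (fun j => m1pow j * indic ((j %% 3)%Z == 0)) (fun j => j * j + j).
Lemma gf_euler6 : is_gf (fun j => m1pow j * indic ((j %% 3)%Z == 0)) (fun j => j * j + j) euler6.
Proof. by apply/gf_spec/gf_ex1 => M; exists M.+1 => a _; nia. Qed.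

(** Together with [lambert_odd], up to sign, the halves with [b] even and [b] odd of the sum of
    (-1)^a chi3(b) q^(a^2 + a b), weighted by [eps1]. Here [b] has been halved, and chi3(2b) = -
    chi3(b). *)
Definition lambert_even := gf (fun p => m1pow p.1 * (chi3 p.2 * eps1 p.1 p.2))
  (fun p => p.1 * p.1 + 2 * p.1 * p.2).
Lemma gf_lambert_even : is_gf (fun p => m1pow p.1 * (chi3 p.2 * eps1 p.1 p.2))
  (fun p => p.1 * p.1 + 2 * p.1 * p.2) lambert_even.
Proof.
apply/gf_spec/gf_ex2 => M; exists (8 * M + 8)%N => a b /=.
rewrite mulrA => /indicB_neq0 h1 h2; have := sqr_bound a.
have /mul_bound : 0 < a * b by apply: sgn_mul_gt0; lia.
by move: h2; rewrite -mulrA; move: (a * a) (a * b) => x y; lia.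
Qed.

(* lambda(q^3) in the notation of the header. *)
Definition appell3 := gf (fun p => m1pow p.1 * eps p.1 p.2)
  (fun p => 9 * p.1 * p.1 + 9 * p.1 + (6 * p.1 + 3) * p.2).
Lemma gf_appell3 : is_gf (fun p => m1pow p.1 * eps p.1 p.2)
  (fun p => 9 * p.1 * p.1 + 9 * p.1 + (6 * p.1 + 3) * p.2) appell3.
Proof.
apply/gf_spec/gf_ex2 => M; exists (8 * M + 8)%N => a b /indicB_neq0 /=.
move=> h1 h2; have := sqrD_bound a.
have : `|b| <= b * (6 * a + 3) by apply: mul_boundr; lia.
by rewrite mulrC; move: h2; rewrite -mulrA; move: ((6 * a + 3) * b) (a * a) => x y; lia.
Qed.

Lemma euler6_lambert_even :
  euler6 + 3%:~R * (euler6 * lambert_even) =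
  euler_cube_q2 + 3%:~R * (q ^+ 2 * (phiN * appell3)).
Proof.
pose T := (int * (int * int))%type.
(* The factor [q ^+ 2] completes a^2 - 3a to (a - 1)(a - 2), which is i^2 + i for i = a - 2: the
   exponents of [euler6] and [euler_cube_q2]. *)
pose e (p : T) := (p.1 - 1) * (p.1 - 2) + 3 * (2 * p.2.1 + 1) * p.2.2.
have gfA : is_gf (fun p : T => m1pow p.1 * eps p.2.1 (p.2.2 - 3 * p.2.1 - p.1)) e
    (q ^+ 2 * (phiN * appell3)).
  have e1 (i : int) : m1pow i != 0 -> 0 <= i * i by nia.
  have e2 (p : int * int) : m1pow p.1 * eps p.1 p.2 != 0 ->
      0 <= 9 * p.1 * p.1 + 9 * p.1 + (6 * p.1 + 3) * p.2.
    by move=> /indicB_neq0; nia.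
  have := gf_shift 2 (gfM gf_phiN gf_appell3 e1 e2).
  move=> gfA0; apply: (gf_reindex
      (h := fun p : T => (p.1 + 3 * p.2.1, (p.2.1, p.2.2 - 3 * p.2.1 - p.1)))
    (g := fun p : T => (p.1 - 3 * p.2.1, (p.2.1, p.2.2 + p.1))) (gfA0 _)).
  - by move=> [a b] /=; rewrite mulf_eq0 negb_or => /andP[/e1 ? /e2 ?]; apply: addr_ge0.
  - by move=> [a [b c]] /=; congr (_, (_, _)); ring.
  - by move=> [a [b c]] _ /=; congr (_, (_, _)); ring.
  - move=> [a [b c]] /=; rewrite mulrA -m1powD; congr (_ * _); rewrite /m1pow; lia.
  - by move=> [a [b c]] _; rewrite /e /=; ring.
have gfB : is_gf (fun p : T => m1pow p.1 * eps1 p.2.2 (p.1 + 3 * p.2.1 - p.2.2)) e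
    (- (euler6 * lambert_even)).
  have e1 (i : int) : m1pow i * indic ((i %% 3)%Z == 0) != 0 -> 0 <= i * i + i by nia.
  have e2 (p : int * int) : m1pow p.1 * (chi3 p.2 * eps1 p.1 p.2) != 0 ->
      0 <= p.1 * p.1 + 2 * p.1 * p.2.
    by rewrite mulrA => /indicB_neq0; nia.
  have gfB0 := gfM gf_euler6 gf_lambert_even e1 e2.
  (* The product of the two congruence weights is traded for the single condition that [p.1 + p.2.2]
     is 1 modulo 3. The difference [w] is invariant under [p.1 -> - 1 - p.1], which flips the sign,
     so it contributes nothing; and the new condition is solved by a linear change of variables. *)
  pose w (p : T) := indic (((p.1 + p.2.2) %% 3)%Z == 1) - indic ((p.1 %% 3)%Z == 0) * chi3 p.2.2.
  have gf0 : is_gf (fun p : T => m1pow p.1 * m1pow p.2.1 * w p * eps1 p.2.1 p.2.2)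
      (fun p : T => p.1 * p.1 + p.1 + (p.2.1 * p.2.1 + 2 * p.2.1 * p.2.2)) 0.
    apply: (gf_zero (h := fun p : T => (- 1 - p.1, p.2))).
    - apply: gf_ex3 => M; exists (8 * M + 8)%N => a b c /indicB_neq0 /= h1 h2.
      have := sqrD_bound a; have := sqr_bound b.
      have /mul_bound : 0 < b * c by apply: sgn_mul_gt0; lia.
      by move: h2; rewrite -mulrA; move: (a * a) (b * b) (b * c) => x y z; lia.
    - by move=> [a [b c]] /=; congr (_, _); ring.
    - by move=> [a [b c]] _ /=; ring.
    - move=> [a [b c]] /=; have -> : m1pow (- 1 - a) = - m1pow a by rewrite /m1pow; lia.
      have -> : w (- 1 - a, (b, c)) = w (a, (b, c)) by rewrite /w /chi3 /indic /=; lia.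
      by ring.
  have := gfZ (-1) (gfD gfB0 gf0); rewrite addr0 mulN1r => gfB1.
  apply: (gf_reindex
      (h := fun p : T => (p.2.2 + 1 - p.1, (p.2.2, p.1 + 3 * p.2.1 - p.2.2)))
    (g := fun p : T => (p.2.1 + 1 - p.1, (((p.1 + p.2.2 - 1) %/ 3)%Z, p.2.1))) gfB1).
  - by move=> [a [b c]] /=; congr (_, (_, _)); lia.
  - move=> [a [b c]] /= h; congr (_, (_, _)); first by lia.
    suff : ((a + c) %% 3)%Z = 1 by lia.
    apply/eqP; apply: contraNT h => /negbTE h; rewrite /w /= h (_ : indic false = 0) //;
      apply/eqP; ring.
  - move=> [a [b c]] /=; rewrite /w /=.
    have -> : ((c + 1 - a + (a + 3 * b - c)) %% 3)%Z == 1 by lia.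
    have -> : m1pow (c + 1 - a) = - (m1pow a * m1pow c) by rewrite -m1powD /m1pow; lia.
    have : m1pow c * m1pow c = 1 by rewrite /m1pow; have [] : (c %% 2)%Z = 0 \/ (c %% 2)%Z = 1;
      [lia|move=> ->|move=> ->].
    rewrite (_ : indic true = 1) //; move: (m1pow c) (m1pow a) (eps1 _ _) => x y E xx.
    transitivity (x * x * (y * E)); first ring.
    by rewrite xx mul1r.
  - by move=> [a [b c]] _; rewrite /e /=; ring.
have gfP : is_gf (fun p : T => m1pow p.1 * indic ((0 <= p.2.1) && (0 < p.2.2))) e 0.
  apply: (gf_zero (h := fun p : T => (3 - p.1, p.2))).
  - apply: gf_ex3 => M; exists (8 * M + 8)%N => a b c /indic_neq0 /=; rewrite /e /=.
    move=> h1 h2; have := sqrB_bound (a - 1).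
    have /mul_bound : 0 < (2 * b + 1) * c by apply: sgn_mul_gt0; lia.
    move: h2; have -> : (a - 1) * (a - 2) = (a - 1) * (a - 1) - (a - 1) by ring.
    by rewrite -mulrA; move: ((2 * b + 1) * c) ((a - 1) * (a - 1)) => x y; lia.
  - by move=> [a [b c]] /=; congr (_, _); ring.
  - by move=> [a [b c]] _; rewrite /e /=; ring.
  - by move=> [a [b c]] /=; rewrite -mulNr; congr (_ * _); rewrite /m1pow; lia.
have gfN : is_gf (fun p : T => m1pow p.1 * indic ((p.2.1 < 0) && (p.2.2 < 0))) e 0.
  apply: (gf_zero (h := fun p : T => (3 - p.1, p.2))).
  - apply: gf_ex3 => M; exists (8 * M + 8)%N => a b c /indic_neq0 /=; rewrite /e /=.
    move=> h1 h2; have := sqrB_bound (a - 1).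
    have /mul_bound : 0 < (2 * b + 1) * c by apply: sgn_mul_gt0; lia.
    move: h2; have -> : (a - 1) * (a - 2) = (a - 1) * (a - 1) - (a - 1) by ring.
    by rewrite -mulrA; move: ((2 * b + 1) * c) ((a - 1) * (a - 1)) => x y; lia.
  - by move=> [a [b c]] /=; congr (_, _); ring.
  - by move=> [a [b c]] _; rewrite /e /=; ring.
  - by move=> [a [b c]] /=; rewrite -mulNr; congr (_ * _); rewrite /m1pow; lia.
(* A boundary term: on the line [p.1 + 3 * p.2.1 = p.2.2] the weight [eps1] vanishes but [eps] need
   not. Along this line the exponent is c^2 + 9(b^2 + b) + 2, invariant under [b -> - 1 - b]. *)
have gfE : is_gf (fun p : T => m1pow p.1 * indic ((p.2.2 < 0) && (p.1 == p.2.2 - 3 * p.2.1))) e 0.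
  apply: (gf_zero (h := fun p : T => (p.1 + 6 * p.2.1 + 3, (- 1 - p.2.1, p.2.2)))).
  - apply: gf_ex3 => M; exists (40 * M + 40)%N => a b c /indic_neq0 /=; rewrite /e /=.
    move=> /andP[_ /eqP->].
    have -> : (c - 3 * b - 1) * (c - 3 * b - 2) + 3 * (2 * b + 1) * c =
      c * c + 9 * (b * b + b) + 2 by ring.
    by have := sqr_bound c; have := sqrD_bound b; lia.
  - by move=> [a [b c]] /=; congr (_, (_, _)); ring.
  - by move=> [a [b c]] /indic_neq0 /= /andP[_ /eqP->]; rewrite /e /=; ring.
  - move=> [a [b c]] /=; rewrite -[RHS]mulNr; congr (_ * _); first by rewrite /m1pow; lia.
    by congr indic; congr (_ && _); lia.
have := gfD gfA (gfD gfB (gfD (gfZ (-1) gfP)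
  (gfD gfN (gfZ (-1) gfE)))).
rewrite !mulr0 !addr0.
set s4 := (X in is_gf _ _ X) => gf4.
have {gf4} : is_gf (fun p : int * int => m1pow p.2 * signed_range ((3 - p.2) %/ 3)%Z p.1)
    (fun p => (p.2 - 1) * (p.2 - 2)) s4.
  apply: (gf_reindex (h := fun p : int * int => (p.2, (p.1, 0)))
    (g := fun p : T => (p.2.1, p.1)) gf4).
  - by case.
  - move=> [a [b c]] /=; rewrite !mulN1r -!mulrN -!mulrDr mulf_eq0 negb_or.
    move=> /andP[_] h; congr (_, (_, _)); move: h; rewrite /eps /eps1 /indic; lia.
  - move=> [a b] /=; rewrite !mulN1r -!mulrN -!mulrDr; congr (_ * _).
    by rewrite /eps /eps1 /indic /signed_range /indic; lia.
  - by move=> [a b] _; rewrite /e /=; ring.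
move=> /(gf_fold (c := fun i => m1pow i * ((3 - i) %/ 3)%Z)
  (e := fun i => (i - 1) * (i - 2))) gf1.
have {}gf1 := gf1 (fun j => is_sumZ (m1pow j) (is_sum_signed_range _)).
have {}gf1 : is_gf (fun i => m1pow i * ((1 - i) %/ 3)%Z) (fun i => i * i + i) s4.
  apply: (gf_reindex (h := fun i : int => i + 2) (g := fun i => i - 2) gf1).
  - by move=> i; ring.
  - by move=> i _; ring.
  - by move=> i; congr (_ * _); [rewrite /m1pow|]; lia.
  - by move=> i _; ring.
(* All series now have exponent i^2 + i. Their combined weight is [m1pow i] times a function
   invariant under [i -> - 1 - i], hence it is odd. *)
have := gfD gf_euler6 (gfD (gfZ (- 3) gf1) (gfZ (-1) gf_euler_cube_q2)).
move=> /(gf_odd (h := fun i : int => - 1 - i)) eq0.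
suff : euler6 + ((-3)%:~R * s4 + (-1)%:~R * euler_cube_q2) = 0.
  by rewrite /s4 => eq1; apply/eqP; rewrite -subr_eq0 -eq1; apply/eqP; ring.
apply: eq0.
- by move=> i; ring.
- by move=> i _; ring.
- move=> i; rewrite (mulrCA (-3)) (mulrCA (-1)) -!mulrDr.
  rewrite (mulrCA (-3)) (mulrCA (-1)) -!mulrDr -mulNr; congr (_ * _).
    by rewrite /m1pow; lia.
  by rewrite /indic; lia.
Qed.

Definition eps2 (a b : int) : int := indic ((0 < a) && (0 <= b)) - indic ((a < 0) && (b < 0)).

Lemma is_sum_point (c : int) : is_sum (fun n : int => indic (n == 0) * c) c.
Proof.
exists [:: 0]; last by rewrite big_seq1 mul1r.
by split=> // n; rewrite inE; case: (n == 0); rewrite // (_ : indic false = 0) // mul0r.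
Qed.

Definition lambert_odd := gf (fun p => m1pow p.1 * (chi3 (2 * p.2 + 1) * eps2 p.1 p.2))
  (fun p => p.1 * p.1 + p.1 * (2 * p.2 + 1)).
Lemma gf_lambert_odd : is_gf (fun p => m1pow p.1 * (chi3 (2 * p.2 + 1) * eps2 p.1 p.2))
  (fun p => p.1 * p.1 + p.1 * (2 * p.2 + 1)) lambert_odd.
Proof.
apply/gf_spec/gf_ex2 => M; exists (8 * M + 8)%N => a b /=.
rewrite mulrA => /indicB_neq0 h1 h2; have := sqr_bound a.
have /mul_bound : 0 < a * (2 * b + 1) by apply: sgn_mul_gt0; lia.
by move: h2; move: (a * a) (a * (2 * b + 1)) => x y; lia.
Qed.

Lemma euler6_lambert_odd :
  2%:~R * euler6 + 3%:~R * (euler6 * lambert_odd) = 2%:~R * euler_cube_q2.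
Proof.
pose T := (int * (int * int))%type.
pose e (p : T) := p.1 * p.1 + p.1 + 6 * p.2.1 * p.2.2.
have gfB : is_gf (fun p : T => m1pow p.1 * eps2 p.2.2 (3 * p.2.1 - 1 - p.2.2 - p.1)) e
    (- (euler6 * lambert_odd)).
  have e1 (i : int) : m1pow i * indic ((i %% 3)%Z == 0) != 0 -> 0 <= i * i + i by nia.
  have e2 (p : int * int) : m1pow p.1 * (chi3 (2 * p.2 + 1) * eps2 p.1 p.2) != 0 ->
      0 <= p.1 * p.1 + p.1 * (2 * p.2 + 1).
    by rewrite mulrA => /indicB_neq0; nia.
  have gfB0 := gfM gf_euler6 gf_lambert_odd e1 e2.
  pose w (p : T) := indic (((p.1 + p.2.2) %% 3)%Z == 2)
    + indic ((p.1 %% 3)%Z == 0) * chi3 (2 * p.2.2 + 1).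
  have gf0 : is_gf (fun p : T => m1pow p.1 * m1pow p.2.1 * w p * eps2 p.2.1 p.2.2)
      (fun p : T => p.1 * p.1 + p.1 + (p.2.1 * p.2.1 + p.2.1 * (2 * p.2.2 + 1))) 0.
    apply: (gf_zero (h := fun p : T => (- 1 - p.1, p.2))).
    - apply: gf_ex3 => M; exists (8 * M + 8)%N => a b c /indicB_neq0 /= h1 h2.
      have := sqrD_bound a; have := sqr_bound b.
      have /mul_bound : 0 < b * (2 * c + 1) by apply: sgn_mul_gt0; lia.
      by move: h2; move: (a * a) (b * b) (b * (2 * c + 1)) => x y z; lia.
    - by move=> [a [b c]] /=; congr (_, _); ring.
    - by move=> [a [b c]] _ /=; ring.
    - move=> [a [b c]] /=; have -> : m1pow (- 1 - a) = - m1pow a by rewrite /m1pow; lia.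
      have -> : w (- 1 - a, (b, c)) = w (a, (b, c)).
        rewrite /w /chi3 /indic /=.
        have [c3|[c3|c3]] : (c %% 3)%Z = 0 \/ (c %% 3)%Z = 1 \/ (c %% 3)%Z = 2 by lia.
        - by rewrite (_ : ((2 * c + 1) %% 3)%Z = 1); [rewrite /=; lia | lia].
        - by rewrite (_ : ((2 * c + 1) %% 3)%Z = 0); [rewrite /=; lia | lia].
        - by rewrite (_ : ((2 * c + 1) %% 3)%Z = 2); [rewrite /=; lia | lia].
      by ring.
  have := gfD (gfZ (-1) gfB0) gf0; rewrite addr0 mulN1r => gfB1.
  apply: (gf_reindex
      (h := fun p : T => (p.1 + p.2.2, (p.2.2, 3 * p.2.1 - 1 - p.2.2 - p.1)))
    (g := fun p : T => (p.1 - p.2.1, (((p.1 + p.2.2 + 1) %/ 3)%Z, p.2.1))) gfB1).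
  - by move=> [a [b c]] /=; congr (_, (_, _)); lia.
  - move=> [a [b c]] /= h; congr (_, (_, _)); first by lia.
    suff : ((a + c) %% 3)%Z = 2 by lia.
    apply/eqP; apply: contraNT h => /negbTE h; rewrite /w /= h (_ : indic false = 0) //.
    by apply/eqP; ring.
  - move=> [a [b c]] /=; rewrite /w /=.
    have -> : ((a + c + (3 * b - 1 - c - a)) %% 3)%Z == 2 by lia.
    have -> : m1pow (a + c) = m1pow a * m1pow c by rewrite m1powD.
    have : m1pow c * m1pow c = 1 by rewrite /m1pow; have [] : (c %% 2)%Z = 0 \/ (c %% 2)%Z = 1;
      [lia|move=> ->|move=> ->].
    rewrite (_ : indic true = 1) //; move: (m1pow c) (m1pow a) (eps2 _ _) => x y E xx.
    transitivity (x * x * (y * E)); first ring.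
    by rewrite xx mul1r.
  - by move=> [a [b c]] _; rewrite /e /=; ring.
have gfP : is_gf (fun p : T => m1pow p.1 * indic ((0 < p.2.1) && (0 < p.2.2))) e 0.
  apply: (gf_zero (h := fun p : T => (- 1 - p.1, p.2))).
  - apply: gf_ex3 => M; exists (8 * M + 8)%N => a b c /indic_neq0 /=; rewrite /e /=.
    move=> h1 h2; have := sqrD_bound a.
    have /mul_bound : 0 < b * c by apply: sgn_mul_gt0; lia.
    by move: h2; rewrite -mulrA; move: (b * c) (a * a) => x y; lia.
  - by move=> [a [b c]] /=; congr (_, _); ring.
  - by move=> [a [b c]] _; rewrite /e /=; ring.
  - by move=> [a [b c]] /=; rewrite -[RHS]mulNr; congr (_ * _); rewrite /m1pow; lia.
have gfN : is_gf (fun p : T => m1pow p.1 * indic ((p.2.1 < 0) && (p.2.2 < 0))) e 0.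
  apply: (gf_zero (h := fun p : T => (- 1 - p.1, p.2))).
  - apply: gf_ex3 => M; exists (8 * M + 8)%N => a b c /indic_neq0 /=; rewrite /e /=.
    move=> h1 h2; have := sqrD_bound a.
    have /mul_bound : 0 < b * c by apply: sgn_mul_gt0; lia.
    by move: h2; rewrite -mulrA; move: (b * c) (a * a) => x y; lia.
  - by move=> [a [b c]] /=; congr (_, _); ring.
  - by move=> [a [b c]] _; rewrite /e /=; ring.
  - by move=> [a [b c]] /=; rewrite -[RHS]mulNr; congr (_ * _); rewrite /m1pow; lia.
pose k (m x : int) := indic ((m < 0) && (0 <= x)) - indic ((0 < m) && (x < 0)).
have gfK : is_gf (fun p : T => m1pow p.1 * k p.2.1 (3 * p.2.1 - 1 - p.2.2 - p.1)) e 0.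
  have gfK0 : is_gf (fun p : T => m1pow p.1 * m1pow p.2.1 * k p.2.1 p.2.2)
    (fun p : T => p.1 * p.1 + p.1 + 9 * p.2.1 * p.2.1 - 3 * p.2.1
      - 6 * p.2.1 * p.2.2) 0.
    apply: (gf_zero (h := fun p : T => (- 1 - p.1, p.2))).
    - apply: gf_ex3 => M; exists (8 * M + 8)%N => a b c /indicB_neq0 /=.
      move=> h1 h2; have := sqrD_bound a; have := sqr_bound b.
      have : `|c| <= c * (- b) by apply: mul_boundr; lia.
      by move: h2; rewrite mulrN [c * b]mulrC -!mulrA; move: (b * c) (a * a) (b * b) => x y z;
        lia.
    - by move=> [a [b c]] /=; congr (_, _); ring.
    - by move=> [a [b c]] _; rewrite /=; ring.
    - move=> [a [b c]] /=; have -> : m1pow (- 1 - a) = - m1pow a by rewrite /m1pow; lia.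
      by ring.
  apply: (gf_reindex (h := fun p : T => (p.1 - 3 * p.2.1, (p.2.1, 3 * p.2.1 - 1 - p.2.2 - p.1)))
    (g := fun p : T => (p.1 + 3 * p.2.1, (p.2.1, - 1 - p.2.2 - p.1))) gfK0).
  - by move=> [a [b c]] /=; congr (_, (_, _)); ring.
  - by move=> [a [b c]] _ /=; congr (_, (_, _)); ring.
  - by move=> [a [b c]] /=; rewrite -m1powD; congr (_ * _); rewrite /m1pow; lia.
  - by move=> [a [b c]] _; rewrite /e /=; ring.
(* The term 6 b c vanishes on both axes, so terms survive on each. On [c = 0] the family [gfB] is
   empty and subtracting [k] leaves [w5]; on [b = 0] only [gfB] remains, with weight [w6]. Both
   weights vanish at the origin. *)
pose w5 (i m : int) := indic ((0 < m) && (3 * m - 1 < i)) - indic ((m < 0) && (i <= 3 * m - 1)).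
pose w6 (i n : int) := indic ((0 < n) && (i <= - 1 - n)) - indic ((n < 0) && (- 1 - n < i)).
have [s5 gf5] : exists s,
    is_gf (fun p : T => m1pow p.1 * (indic (p.2.2 == 0) * w5 p.1 p.2.1)) e s.
  apply: gf_ex3 => M; exists (8 * M + 8)%N => a b c /=; rewrite mulrA => h1.
  have c0 : c = 0 by apply/eqP; apply: contraNT h1 => /negbTE->; rewrite mulr0 mul0r.
  by move: h1 => /indicB_neq0; rewrite /e /= c0 mulr0 addr0 => h1 h2; have := sqrD_bound a; lia.
have := gfD gfB (gfD (gfZ (-1) gfP) (gfD gfN (gfD (gfZ (-1) gfK) (gfZ (-1) gf5)))).
rewrite !mulr0 !add0r.
set s6 := (X in is_gf _ _ X) => gf6.
have {}gf5 : is_gf (fun i => m1pow i * (((i %/ 3)%Z + 1) - indic (0 <= i)))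
  (fun i => i * i + i) s5.
  have {}gf5 : is_gf (fun p : int * int => m1pow p.2 * w5 p.2 p.1)
      (fun p => p.2 * p.2 + p.2) s5.
    apply: (gf_reindex (h := fun p : int * int => (p.2, (p.1, 0)))
      (g := fun p : T => (p.2.1, p.1)) gf5).
    - by case.
    - move=> [a [b c]] /= h; congr (_, (_, _)); apply/esym/eqP.
      by apply: contraNT h => /negbTE->; rewrite mul0r mulr0.
    - by move=> [a b] /=; rewrite mul1r.
    - by move=> [a b] _; rewrite /e /=; ring.
  apply: (gf_fold (e := fun i => i * i + i) gf5) => j /=; apply: is_sumZ.
  (* The range counts [m = 0] exactly when [0 <= j], whereas [w5] omits it; the point mass corrects
     this. *)
  have := is_sumD (is_sum_signed_range ((j %/ 3)%Z + 1)) (is_sum_point (- indic (0 <= j))).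
  by apply: eq_is_sum => m; rewrite /w5 /signed_range /indic; case: eqP => ?; lia.
have {}gf6 : is_gf (fun i => m1pow i * (- i - indic (i <= - 1))) (fun i => i * i + i) s6.
  have {}gf6 : is_gf (fun p : int * int => m1pow p.2 * w6 p.2 p.1)
      (fun p => p.2 * p.2 + p.2) s6.
    apply: (gf_reindex (h := fun p : int * int => (p.2, (0, p.1)))
      (g := fun p : T => (p.2.2, p.1)) gf6).
    - by case.
    - move=> [a [b c]] /=; rewrite !mulN1r -!mulrN -!mulrDr mulf_eq0 negb_or.
      move=> /andP[_] h; congr (_, (_, _)); move: h; rewrite /eps2 /k /w5 /indic.
      by case: (c =P 0) => c0; lia.
    - move=> [a b] /=; rewrite !mulN1r -!mulrN -!mulrDr; congr (_ * _).
      by rewrite /eps2 /k /w5 /w6 /indic; case: (b =P 0) => b0; lia.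
    - by move=> [a b] _; rewrite /e /=; ring.
  apply: (gf_fold (e := fun i => i * i + i) gf6) => j /=; apply: is_sumZ.
  have := is_sumD (is_sum_signed_range (- j)) (is_sum_point (- indic (j <= - 1))).
  by apply: eq_is_sum => m; rewrite /w6 /signed_range /indic; case: eqP => ?; lia.
have := gfD (gfZ 2 gf_euler6) (gfD (gfZ (- 3) (gfD gf5 gf6)) (gfZ (-2) gf_euler_cube_q2)).
move=> /(gf_odd (h := fun i : int => - 1 - i)) eq0.
suff : 2%:~R * euler6 + ((-3)%:~R * (s5 + s6) + (-2)%:~R * euler_cube_q2) = 0.
  by rewrite /s6 => eq1; apply/eqP; rewrite -subr_eq0 -eq1; apply/eqP; ring.
apply: eq0.
- by move=> i; ring.
- by move=> i _; ring.
- move=> i; rewrite -!mulrDr !(mulrCA _ (m1pow _)) -!mulrDr -[RHS]mulNr; congr (_ * _).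
    by rewrite /m1pow; lia.
  by rewrite /indic; lia.
Qed.

(** * The square of psi *)

Definition dil (k : nat) (f : fps) : fps :=
  Fps (fun n => if (k %| n)%N then f (n %/ k)%N else 0).

Lemma dilE k f n : dil k f n = if (k %| n)%N then f (n %/ k)%N else 0.
Proof. by []. Qed.

Lemma gf_dil (I : eqType) (w e : I -> int) s k : (0 < k)%N ->
  is_gf w e s -> is_gf w (fun i => k%:Z * e i) (dil k s).
Proof.
move=> k0 ws M; rewrite dilE; case: ifP => [kM|nkM].
  apply: eq_is_sum (ws _) => i; congr (if _ then _ else _).
  rewrite -{2}(divnK kM) mulnC PoszM; apply/eqP/eqP => [->//|].
  by apply: mulfI; rewrite eqz_nat -lt0n.
apply: is_sum0 => i; case: eqP => // eM; case/negP: nkM.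
have : (k%:Z %| M%:Z)%Z by rewrite -eM dvdz_mulr.
by rewrite dvdzE.
Qed.

(** A series is the generating function of its own coefficients; [dilM] and [trisect_mul] thereby
    become reindexings of families. *)
Lemma gf_fps (f : fps) : is_gf f Posz f.
Proof.
move=> M; exists [:: M]; last by rewrite big_seq1 eqxx.
by split=> // i; case: (i%:Z =P M%:Z) => [[->] _|]; rewrite ?inE.
Qed.

Lemma dilM k f g : (0 < k)%N -> dil k (f * g) = dil k f * dil k g.
Proof.
move=> k0; have nneg (h : fps) (i : nat) : h i != 0 -> 0 <= i%:Z by [].
have dnneg (h : fps) (i : nat) : h i != 0 -> 0 <= k%:Z * i%:Z by [].
have := gfM (gf_dil k0 (gf_fps f)) (gf_dil k0 (gf_fps g)) (dnneg f) (dnneg g).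
apply: gf_uniq; have := gf_dil k0 (gfM (gf_fps f) (gf_fps g) (nneg f) (nneg g)).
by apply: eq_is_gf => // i _; rewrite mulrDr.
Qed.

Lemma dilD k f g : dil k (f + g) = dil k f + dil k g.
Proof. by apply: fpsP => n; rewrite fpsDE !dilE; case: ifP; rewrite ?fpsDE ?addr0. Qed.

Lemma dilZ k c f : dil k (c%:~R * f) = c%:~R * dil k f.
Proof. by apply: fpsP => n; rewrite fps_intE !dilE; case: ifP; rewrite ?fps_intE ?mulr0. Qed.

Lemma dilN k f : dil k (- f) = - dil k f.
Proof. by apply: fpsP => n; rewrite fpsNE !dilE; case: ifP; rewrite ?fpsNE ?oppr0. Qed.

Lemma dil1 k : (0 < k)%N -> dil k 1 = 1.
Proof.
move=> k0; apply: fpsP => n; rewrite dilE !fps1E; case: ifP => [kn|].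
  by rewrite -{2}(divnK kn) muln_eq0 (gtn_eqF k0) orbF.
by case: eqP => // ->; rewrite dvdn0.
Qed.

Lemma dil_ge0 k (f : fps) : (forall n, 0 <= f n) -> forall n, 0 <= dil k f n.
Proof. by move=> f0 n; rewrite dilE; case: ifP. Qed.

Lemma dil_dil k l f : (0 < k)%N -> dil k (dil l f) = dil (k * l) f.
Proof.
move=> k0; apply: fpsP => n; rewrite !dilE; case: ifP => kn; last first.
  by rewrite ifF //; apply: contraFF kn; apply: dvdn_trans; rewrite dvdn_mulr.
by rewrite dvdn_divRL // -divnMA [(l * k)%N]mulnC.
Qed.

Definition trisect (r : nat) (f : fps) : fps := Fps (fun n => f (3 * n + r)%N).

Lemma trisectE r f n : trisect r f n = f (3 * n + r)%N.
Proof. by []. Qed.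

Lemma trisect_mul r f g : (r < 3)%N -> trisect r (dil 3 f * g) = f * trisect r g.
Proof.
move=> r3; have nneg (h : fps) (i : nat) : h i != 0 -> 0 <= i%:Z by [].
have dnneg (h : fps) (i : nat) : h i != 0 -> 0 <= 3%:Z * i%:Z by [].
have lfg := gfM (gf_dil (isT : (0 < 3)%N) (gf_fps f)) (gf_fps g) (dnneg f) (nneg g).
apply: fpsP => M; rewrite trisectE.
apply: is_sum_uniq (gfM (gf_fps f) (gf_fps (trisect r g)) (nneg f) (nneg _) M).
have := lfg (3 * M + r)%N; rewrite (is_sum_bij (J := (nat * nat)%type) _
  (h := fun p => (p.1, 3 * p.2 + r)%N) (g := fun p => (p.1, (p.2 - r) %/ 3)%N)) /=.
- apply: eq_is_sum => -[i j] /=; rewrite trisectE; congr (if _ then _ else _); lia.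
- by move=> [i j] /=; congr (_, _); lia.
- move=> [i j] /=; case: (3%:Z * i%:Z + j%:Z =P _) => // eM _; congr (_, _); lia.
Qed.

Lemma mul_fps0 (f g : fps) : (f * g) 0%N = f 0%N * g 0%N.
Proof. by rewrite fpsME big_ord1. Qed.

Lemma mul_fps_lead (f g : fps) n : (forall m, (m < n)%N -> g m = 0) ->
  (f * g) n = f 0%N * g n.
Proof.
move=> g0; rewrite fpsME big_ord_recl subn0 big1 ?addr0 // => i _.
by rewrite g0 ?mulr0 // lift0; have := ltn_ord i; lia.
Qed.

Lemma fps_mulIf (f g h : fps) : f 0%N != 0 -> f * g = f * h -> g = h.
Proof.
move=> f0 fgh; apply/eqP; rewrite -subr_eq0; apply/eqP.
have : f * (g - h) = 0 by rewrite mulrBr fgh subrr.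
move: (g - h) => k fk; apply: fpsP; elim/ltn_ind => n IHn.
by have := congr1 (fun u : fps => u n) fk; rewrite /= mul_fps_lead // fps0E
  => /eqP; rewrite mulf_eq0 (negbTE f0) => /eqP.
Qed.

Definition tri (a : int) : int := ((a * a - a) %/ 2)%Z.
Lemma tri2 a : 2 * tri a = a * a - a.
Proof.
have /divzK : (2 %| a * a - a)%Z.
  have [] : (a %% 2)%Z = 0 \/ (a %% 2)%Z = 1 by lia.
    move=> a0; have -> : a * a - a = a * (a - 1) by ring.
    by rewrite dvdz_mulr //; lia.
  move=> a1; have -> : a * a - a = a * (a - 1) by ring.
  by rewrite dvdz_mull //; lia.
by rewrite /tri mulrC.
Qed.

(* 2 psi(q), as a bilateral sum. *)
Definition Psi := gf (fun=> 1) tri.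
Lemma gf_Psi : is_gf (fun=> 1) tri Psi.
Proof.
apply/gf_spec/gf_ex1 => M; exists (2 * M + 2)%N => a _ aM.
by have := tri2 a; have := sqrB_bound a; rewrite aM; lia.
Qed.

(** Jacobi's series for (q)_oo^3: the indices [n + 1] and [- n] share the exponent n(n+1)/2, and
    their weights add up to (-1)^n (2n + 1). *)
Definition euler_cube := gf (fun a => - (m1pow a * a)) tri.
Lemma gf_euler_cube : is_gf (fun a => - (m1pow a * a)) tri euler_cube.
Proof.
apply/gf_spec/gf_ex1 => M; exists (2 * M + 2)%N => a _ aM.
by have := tri2 a; have := sqrB_bound a; rewrite aM; lia.
Qed.

Definition phi := gf (fun=> 1) (fun n => n * n).
Lemma gf_phi : is_gf (fun=> 1) (fun n => n * n) phi.
Proof. by apply/gf_spec/gf_ex1 => M; exists M => a _; nia. Qed.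

Lemma tri_ge0 a : 0 <= tri a.
Proof. by have := tri2 a; have := sqrB_bound a; lia. Qed.

Lemma gf_ex_tri (w : int * int -> int) :
  exists s, is_gf w (fun p => tri p.1 + tri p.2) s.
Proof.
apply: gf_ex2 => M; exists (4 * M + 4)%N => a b _ /=.
by have := tri2 a; have := sqrB_bound a; have := tri2 b; have := sqrB_bound b; lia.
Qed.

Lemma tri_diag d h : tri (d + h) + tri (d - h) = h * h + 2 * tri d.
Proof. by have := tri2 (d + h); have := tri2 (d - h); have := tri2 d; lia. Qed.

(** The reflection [a -> 1 - a] lets the weight [a] be replaced by [a + b], and the swap of [a] and
    [b] cancels the pairs with odd sum. The others are (d + h, d - h), where the exponent separates
    into h^2 + 2 tri(d). *)
Lemma euler_cube_Psi : euler_cube * Psi = 2%:~R * (phiN * dil 2 euler_cube).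
Proof.
pose e (p : int * int) := tri p.1 + tri p.2.
have tri0 (w : int -> int) a : w a != 0 -> 0 <= tri a by rewrite tri_ge0.
have := gfM gf_euler_cube gf_Psi (tri0 _) (tri0 _).
have gf0 : is_gf (fun p : int * int => m1pow p.1 * p.2) e 0.
  apply: (gf_zero (h := fun p : int * int => (1 - p.1, p.2))).
  - exact: gf_ex_tri.
  - by move=> [a b] /=; congr (_, _); ring.
  - by move=> [a b] _; rewrite /e /=; have := tri2 a; have := tri2 (1 - a); lia.
  - by move=> [a b] /=; rewrite -[RHS]mulNr; congr (_ * _); rewrite /m1pow; lia.
have gf1 :
    is_gf (fun p : int * int => m1pow p.1 * (p.1 + p.2) * indic (((p.1 + p.2) %% 2)%Z == 1)) e 0.
  apply: (gf_zero (h := fun p : int * int => (p.2, p.1))).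
  - exact: gf_ex_tri.
  - by case.
  - by move=> [a b] _; rewrite /e /=; ring.
  - move=> [a b] /=; rewrite [b + a]addrC; case: eqP => [ab|_]; last by rewrite !mulr0 oppr0.
    have -> : m1pow b = - m1pow a by rewrite /m1pow; lia.
    by ring.
move=> lJ; have := gfD lJ (gfD (gfZ (-1) gf0) gf1); rewrite !(mulr0, addr0) => gf2.
apply: gf_uniq (gfZ 2 (gfM gf_phiN (gf_dil (isT : (0 < 2)%N) gf_euler_cube) _ _)); last 2 first.
- by move=> i _; nia.
- by move=> i _; have := tri_ge0 i; lia.
apply: (gf_reindex (h := fun p : int * int => (p.2 + p.1, p.2 - p.1))
  (g := fun p : int * int => (((p.1 - p.2) %/ 2)%Z, ((p.1 + p.2) %/ 2)%Z)) gf2).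
- by move=> [a b] /=; congr (_, _); lia.
- move=> [a b] /=; have [ab|] : ((a + b) %% 2)%Z = 0 \/ ((a + b) %% 2)%Z = 1 by lia.
    by move=> _; congr (_, _); lia.
  by move=> -> h; case/eqP: h; rewrite (_ : indic (1 == 1) = 1) //; ring.
- move=> [a b] /=; have -> : (((b + a + (b - a)) %% 2)%Z == 1) = false by lia.
  by rewrite (_ : indic false = 0) // m1powD; ring.
- by move=> [a b] _; rewrite /= tri_diag.
Qed.

(** The reflection [b -> 1 - b] exchanges the pairs with even and with odd sum, so both halves equal
    the one parametrized by (d + h, d - h). *)
Lemma Psi_Psi : Psi * Psi = 2%:~R * (phi * dil 2 Psi).
Proof.
pose e (p : int * int) := tri p.1 + tri p.2.
have tri0 (w : int -> int) a : w a != 0 -> 0 <= tri a by rewrite tri_ge0.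
have gfPP := gfM gf_Psi gf_Psi (tri0 _) (tri0 _).
have [s gf0] := gf_ex_tri (fun p => indic (((p.1 + p.2) %% 2)%Z == 0)).
have gf1 : is_gf (fun p : int * int => indic (((p.1 + p.2) %% 2)%Z == 1)) e s.
  apply: (gf_reindex (h := fun p : int * int => (p.1, 1 - p.2))
    (g := fun p : int * int => (p.1, 1 - p.2)) gf0).
  - by move=> [a b] /=; congr (_, _); ring.
  - by move=> [a b] _ /=; congr (_, _); ring.
  - by move=> [a b] /=; rewrite /indic; lia.
  - by move=> [a b] _; rewrite /e /=; have := tri2 b; have := tri2 (1 - b); lia.
have -> : Psi * Psi = 2%:~R * s.
  apply: gf_uniq gfPP _; have := gfD gf0 gf1; have -> : s + s = 2%:~R * s by ring.
  by apply: eq_is_gf => // -[a b]; rewrite /indic /=; lia.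
congr (_ * _).
apply: gf_uniq (gfM gf_phi (gf_dil (isT : (0 < 2)%N) gf_Psi) _ _); last 2 first.
- by move=> i _; nia.
- by move=> i _; have := tri_ge0 i; lia.
apply: (gf_reindex (h := fun p : int * int => (p.2 + p.1, p.2 - p.1))
  (g := fun p : int * int => (((p.1 - p.2) %/ 2)%Z, ((p.1 + p.2) %/ 2)%Z)) gf0).
- by move=> [a b] /=; congr (_, _); lia.
- by move=> [a b] h; congr (_, _); move: h; rewrite /indic /=; lia.
- by move=> [a b] /=; rewrite /indic; lia.
- by move=> [a b] _; rewrite /= tri_diag.
Qed.

(** The classical phi(q) phi(-q) = phi(-q^2)^2: pairs with odd sum cancel under the swap, and the
    rest are (a + b, a - b). *)
Lemma phi_phiN : phi * phiN = dil 2 (phiN * phiN).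
Proof.
have sq0 (w : int -> int) a : w a != 0 -> 0 <= a * a by nia.
have gfPP := gfM gf_phi gf_phiN (sq0 _) (sq0 _).
have gf1 : is_gf (fun p : int * int => m1pow p.2 * indic (((p.1 + p.2) %% 2)%Z == 1))
    (fun p => p.1 * p.1 + p.2 * p.2) 0.
  apply: (gf_zero (h := fun p : int * int => (p.2, p.1))).
  - apply: gf_ex2 => M; exists (4 * M + 4)%N => a b _ /=.
    by have := sqr_bound a; have := sqr_bound b; lia.
  - by case.
  - by move=> [a b] _ /=; ring.
  - move=> [a b] /=; rewrite [b + a]addrC; case: eqP => [ab|_]; last by rewrite !mulr0 oppr0.
    have -> : m1pow b = - m1pow a by rewrite /m1pow; lia.
    by ring.
have := gfD gfPP (gfZ (-1) gf1); rewrite mulr0 addr0 => gf2.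
apply: gf_uniq (gf_dil (isT : (0 < 2)%N) (gfM gf_phiN gf_phiN (sq0 _) (sq0 _))).
apply: (gf_reindex (h := fun p : int * int => (p.1 + p.2, p.1 - p.2))
  (g := fun p : int * int => (((p.1 + p.2) %/ 2)%Z, ((p.1 - p.2) %/ 2)%Z)) gf2).
- by move=> [a b] /=; congr (_, _); lia.
- move=> [a b] /=; have [ab|] : ((a + b) %% 2)%Z = 0 \/ ((a + b) %% 2)%Z = 1 by lia.
    by move=> _; congr (_, _); lia.
  by move=> -> h; case/eqP: h; rewrite (_ : indic (1 == 1) = 1) //; ring.
- move=> [a b] /=; have -> : (((a + b + (a - b)) %% 2)%Z == 1) = false by lia.
  by rewrite (_ : indic false = 0) // m1powD m1powN; ring.
- by move=> [a b] _; rewrite /=; ring.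
Qed.

Lemma phiN_0 : phiN 0%N = 1.
Proof.
rewrite (is_sum_seq (gf_phiN 0) (r := [:: 0])) // ?big_seq1 // => i; rewrite inE.
by case: (i * i =P 0) => // i0 _; nia.
Qed.

Lemma Psi_0 : Psi 0%N = 2.
Proof.
rewrite (is_sum_seq (gf_Psi 0) (r := [:: 0; 1])) // ?big_cons ?big_nil // => i.
by rewrite !inE; case: (tri i =P 0) => // i0 _; have := tri2 i; nia.
Qed.

Lemma euler_cube_0 : euler_cube 0%N = 1.
Proof.
rewrite (is_sum_seq (gf_euler_cube 0) (r := [:: 0; 1])) // ?big_cons ?big_nil // => i.
by rewrite !inE; case: (tri i =P 0) => // i0 _; have := tri2 i; nia.
Qed.

(* Both sides of [2 (q)_oo^3 = phi(-q)^2 * Psi] satisfy [f(q) Psi(q) = 2 phi(-q) f(q^2)],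
   which determines [f] from its constant term. *)
Lemma fps_dil2_fixpoint (f : fps) :
  f * Psi = 2%:~R * (phiN * dil 2 f) -> f 0%N = 0 -> f = 0.
Proof.
move=> fE f0; apply: fpsP; elim/ltn_ind => -[//|n] IHn.
have := congr1 (fun u : fps => u n.+1) fE.
rewrite /= mulrC mul_fps_lead // Psi_0 fps_intE fpsME big1 => [|i _].
  by rewrite fps0E; lia.
rewrite dilE; case: ifP => _; rewrite ?mulr0 // IHn ?fps0E ?mulr0 //.
by apply: leq_ltn_trans (leq_div2r 2 (leq_subr _ _)) _; lia.
Qed.

Lemma euler_cube_q2E : euler_cube_q2 = dil 2 euler_cube.
Proof.
apply: gf_uniq (gf_dil (isT : (0 < 2)%N) gf_euler_cube).
apply: (gf_reindex (h := fun i : int => - i) (g := fun i => - i) gf_euler_cube_q2).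
- exact: opprK.
- by move=> i _; rewrite opprK.
- by move=> i; rewrite m1powN mulrN.
- by move=> i _; rewrite tri2; ring.
Qed.

Lemma euler_cubeE : 2%:~R * euler_cube = phiN * phiN * Psi.
Proof.
apply/eqP; rewrite -subr_eq0; apply/eqP/fps_dil2_fixpoint.
  have -> : dil 2 (2%:~R * euler_cube - phiN * phiN * Psi) =
      2%:~R * dil 2 euler_cube - dil 2 (phiN * phiN) * dil 2 Psi.
    rewrite dilD dilZ -(mulN1r (phiN * phiN * Psi)).
    by rewrite (_ : - 1 = (-1)%:~R :> fps) // dilZ !dilM //; ring.
  have -> : (2%:~R * euler_cube - phiN * phiN * Psi) * Psi =
      2%:~R * (euler_cube * Psi) - phiN * phiN * (Psi * Psi) by ring.
  rewrite euler_cube_Psi Psi_Psi -phi_phiN; ring.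
by rewrite fpsBE fps_intE !mul_fps0 phiN_0 Psi_0 euler_cube_0.
Qed.

Lemma Psi_sqr : Psi * Psi = 4%:~R * psi_sq.
Proof.
apply: (@fps_mulIf phiN); first by rewrite phiN_0.
rewrite Psi_Psi (_ : phiN * _ = 2%:~R * (phi * phiN * dil 2 Psi)); last by ring.
rewrite phi_phiN -dilM // -euler_cubeE dilZ -euler_cube_q2E -phiN_psi_sq; ring.
Qed.

(** * Counting overpartitions in a box *)

(** The sum of q^b g_b over all [b]. The powers of q leave finitely many terms in each coefficient,
    so no limit is involved. *)
Definition qsum (g : nat -> fps) : fps := Fps (fun n => \sum_(b < n.+1) g b (n - b)%N).

Lemma qsumE g n : qsum g n = \sum_(b < n.+1) g b (n - b)%N.
Proof. by []. Qed.

Lemma qsum_trunc g K n : (n < K)%N -> qsum g n = (\sum_(b < K) q ^+ b * g b) n.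
Proof.
move=> nK; rewrite fps_sumE qsumE (big_ord_widen K (fun b => g b (n - b)%N)) //.
by rewrite big_mkcond; apply: eq_bigr => b _; rewrite fps_qXM ltnS.
Qed.

Lemma eq_qsum g h : g =1 h -> qsum g = qsum h.
Proof. by move=> /funext ->. Qed.

Lemma qsum_recl g : qsum g = g 0%N + q * qsum (fun b => g b.+1).
Proof.
apply: fpsP => n; rewrite qsumE big_ord_recl subn0 fpsDE fps_qM; congr (_ + _).
case: n => [|n]; first by rewrite big_ord0.
by rewrite qsumE; apply: eq_bigr => b _; rewrite lift0 subSS.
Qed.

Lemma qsumD g h : qsum g + qsum h = qsum (fun b => g b + h b).
Proof.
apply: fpsP => n; rewrite fpsDE !qsumE -big_split; apply: eq_bigr => b _.
by rewrite fpsDE.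
Qed.

Lemma qsum_mull f g : f * qsum g = qsum (fun b => f * g b).
Proof.
apply: fpsP => n; rewrite (qsum_trunc _ (ltnSn n)).
transitivity ((f * \sum_(b < n.+1) q ^+ b * g b) n).
  rewrite !fpsME; apply: eq_bigr => i _; congr (_ * _).
  by apply: qsum_trunc; rewrite ltnS leq_subr.
by rewrite mulr_sumr; congr (fcoef _ n); apply: eq_bigr => b _; rewrite mulrCA.
Qed.

Lemma qsum_ge0 (g : nat -> fps) : (forall b n, 0 <= g b n) -> forall n, 0 <= qsum g n.
Proof. by move=> g0 n; rewrite qsumE; apply: sumr_ge0. Qed.

Lemma fpsM_ge0 (f g : fps) : (forall n, 0 <= f n) -> (forall n, 0 <= g n) ->
  forall n, 0 <= (f * g) n.
Proof. by move=> f0 g0 n; rewrite fpsME; apply: sumr_ge0 => i _; apply: mulr_ge0. Qed.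

Lemma fps_qX_ge0 k n : 0 <= (q ^+ k) n.
Proof. by rewrite -[q ^+ k]mulr1 fps_qXM; case: ifP; rewrite ?fps1E. Qed.

Lemma fpsD_ge0 (f g : fps) : (forall n, 0 <= f n) -> (forall n, 0 <= g n) ->
  forall n, 0 <= (f + g) n.
Proof. by move=> f0 g0 n; rewrite fpsDE addr_ge0. Qed.

Lemma fps_nat_ge0 d n : 0 <= (d%:R : fps) n.
Proof.
by elim: d n => [|d IHd] n //; rewrite mulrS; apply: fpsD_ge0 => // m; rewrite fps1E.
Qed.

Section Delannoy.
Variable d : nat.

(* [q ^ b * delannoy a b] counts the overpartitions into [b] parts that are at most
   [a + 1], the part [a + 1] not being overlined, each overlined part having weight [d].
   For [d = 0] these are the Gaussian binomial coefficients. *)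
Fixpoint delannoy (a : nat) : nat -> fps :=
  if a is a'.+1 then
    fix Da b := if b is b'.+1
      then delannoy a' b + d%:R * q ^+ a' * delannoy a' b' + q ^+ a * Da b' else 1
  else fun=> 1.

Lemma delannoy0l b : delannoy 0 b = 1. Proof. by []. Qed.
Lemma delannoy0r a : delannoy a 0 = 1. Proof. by case: a. Qed.
Lemma delannoy_rec a b : delannoy a.+1 b.+1 =
  delannoy a b.+1 + d%:R * q ^+ a * delannoy a b + q ^+ a.+1 * delannoy a.+1 b.
Proof. by []. Qed.

(** This is the recurrence of the transposed box; compared with the defining one it gives
    [delannoyC], which stands in for conjugation of diagrams. *)
Lemma delannoy_rec_sym a b : delannoy a.+1 b.+1 =
  delannoy a.+1 b + d%:R * q ^+ b * delannoy a b + q ^+ b.+1 * delannoy a b.+1.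
Proof.
elim: a b => [|a IHa] b.
  elim: b => [|b IHb]; first by rewrite delannoy_rec !delannoy0l delannoy0r; ring.
  by rewrite delannoy_rec {1}IHb [delannoy 1 b.+1]delannoy_rec !delannoy0l !exprS; ring.
elim: b => [|b IHb].
  by rewrite delannoy_rec {1}IHa [delannoy a.+1 1]delannoy_rec !delannoy0r !exprS; ring.
have E0 (x y : fps) : x = y -> x - y = 0 by move=> ->; rewrite subrr.
have E1 := E0 _ _ (delannoy_rec a.+1 b.+1).
have E2 := E0 _ _ (IHa b.+1).
have E3 := E0 _ _ (IHa b).
have E4 := E0 _ _ IHb.
have E5 := E0 _ _ (delannoy_rec a.+1 b).
have E6 := E0 _ _ (delannoy_rec a b).
have E7 := E0 _ _ (delannoy_rec a b.+1).
move: E1 E2 E3 E4 E5 E6 E7; rewrite !exprS.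
move: q (delannoy a.+2 b.+2) (delannoy a.+2 b.+1) (delannoy a.+2 b) (delannoy a.+1 b.+2)
  (delannoy a.+1 b.+1) (delannoy a.+1 b)
  (delannoy a b.+2) (delannoy a b.+1) (delannoy a b) (q ^+ a) (q ^+ b) (d%:R : fps).
move=> r x22 x21 x20 x12 x11 x10 x02 x01 x00 qa qb c E1 E2 E3 E4 E5 E6 E7.
(* Expanding the entry (a + 2, b + 2) by the first recurrence and its three terms by the second (E1
   to E4) agrees with expanding in the opposite order, which uses E5 to E7. *)
have := congr2 +%R (congr2 +%R (congr2 +%R E1 E2) (congr2 +%R (congr1 ( *%R (c * (r * qa))) E3)
  (congr1 ( *%R (r * (r * qa))) E4))) (congr1 -%R (congr2 +%R E5 (congr2 +%R
  (congr1 ( *%R (c * (r * qb))) E6) (congr1 ( *%R (r * (r * qb))) E7)))).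
by move=> H; apply: subr0_eq; apply: (etrans _ (etrans H _)); ring.
Qed.

Lemma delannoyC a b : delannoy a b = delannoy b a.
Proof.
elim: a b => [|a IHa] [|b]; rewrite ?delannoy0r ?delannoy0l //.
elim: b => [|b IHb]; first by rewrite delannoy_rec [RHS]delannoy_rec_sym !IHa !delannoy0r.
by rewrite delannoy_rec IHb [RHS]delannoy_rec_sym !IHa.
Qed.

Lemma delannoy_ge0 a b n : 0 <= delannoy a b n.
Proof.
elim: a b n => [|a IHa] b n; first by rewrite fps1E.
elim: b n => [|b IHb] n; first by rewrite fps1E.
rewrite delannoy_rec; apply: fpsD_ge0 => [m|m]; last by apply: fpsM_ge0 => // ?;
  apply: fps_qX_ge0.
apply: fpsD_ge0 => // {}m; apply: fpsM_ge0 => // {}m.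
by apply: fpsM_ge0 => {}m; [apply: fps_nat_ge0|apply: fps_qX_ge0].
Qed.

(** For [d = 1], the series [q ^+ m.+1 * diag_sumq m] is half of the generating function of the
    nonempty overpartitions of rank [m]. The companion [diag_sum] is adjoined so that the
    recurrences of [delannoy] become linear relations between the two families. *)
Definition diag_sum m := qsum (fun b => delannoy (b + m) b).
Definition diag_sumq m := qsum (fun b => q ^+ b * delannoy (b + m) b).

Lemma diag_sum_ge0 m n : 0 <= diag_sum m n.
Proof. by apply: qsum_ge0 => b l; apply: delannoy_ge0. Qed.

Lemma diag_sumq_shift m :
  diag_sumq m = 1 + q ^+ 2 * qsum (fun b => q ^+ b * delannoy (b.+1 + m) b.+1).
Proof.
rewrite /diag_sumq qsum_recl delannoy0r mulr1 expr0 exprS -mulrA; congr (_ + _ * _).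
by rewrite qsum_mull; apply: eq_qsum => b; rewrite exprS mulrA.
Qed.

Lemma diag_sumB m : diag_sum m.+1 - diag_sum m =
  d%:R * q ^+ m.+2 * diag_sumq m.+1 + q ^+ m.+3 * diag_sumq m.+2.
Proof.
rewrite /diag_sum qsum_recl [qsum (fun b => delannoy (b + m) b)]qsum_recl.
rewrite !delannoy0r opprD addrACA subrr add0r.
rewrite -mulrBr (_ : d%:R * q ^+ m.+2 * _ + q ^+ m.+3 * _ =
  q * (d%:R * q ^+ m.+1 * diag_sumq m.+1 + q ^+ m.+2 * diag_sumq m.+2));
    last by rewrite !exprS; ring.
congr (_ * _); rewrite -mulN1r /diag_sumq !qsum_mull !qsumD; apply: eq_qsum => b.
by rewrite !addnS !addSn delannoy_rec !exprS !exprD; ring.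
Qed.

Lemma diag_sum_rec m : diag_sum m.+1 =
  q * diag_sum m.+2 + d%:R * q * diag_sumq m.+1 + diag_sumq m.
Proof.
rewrite {1}/diag_sum qsum_recl delannoy0r (diag_sumq_shift m) (_ : _ + _ * _ + _ =
  1 + q * (diag_sum m.+2 + d%:R * diag_sumq m.+1 +
           q * qsum (fun b => q ^+ b * delannoy (b.+1 + m) b.+1))).
  congr (_ + _ * _); rewrite /diag_sum /diag_sumq !qsum_mull !qsumD; apply: eq_qsum => b.
  by rewrite !addnS addSn delannoy_rec_sym exprS; ring.
by rewrite exprS; ring.
Qed.

Lemma diag_sum_0 :
  diag_sum 0 = 1 + q * diag_sum 1 + d%:R * q * diag_sumq 0 + q ^+ 2 * diag_sumq 1.
Proof.
rewrite {1}/diag_sum qsum_recl delannoy0r (_ : _ + _ + _ + _ =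
  1 + q * (diag_sum 1 + d%:R * diag_sumq 0 + q * diag_sumq 1)); last by rewrite exprS; ring.
congr (_ + _ * _); rewrite /diag_sum /diag_sumq !qsum_mull !qsumD; apply: eq_qsum => b.
by rewrite !addn0 !addn1 delannoy_rec [delannoy b b.+1]delannoyC exprS; ring.
Qed.

End Delannoy.

(** Each use of the equation gains a factor q, so the coefficients vanish by induction on the
    exponent, for all [m] at once. This is the uniqueness principle behind the partial theta
    formulas. *)
Lemma fps_contract (f : nat -> fps) (k l : nat -> nat) :
  (forall m, f m = - (q ^+ (k m).+1 * f (l m))) -> forall m, f m = 0.
Proof.
move=> fE m; apply: fpsP => n; elim/ltn_ind: n m => n IHn m.
rewrite fE fpsNE fps_qXM; case: ifP => // kn; rewrite IHn ?fps0E ?oppr0 //.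
by move: kn; case: n {IHn} => // n _; rewrite subSS ltnS leq_subr.
Qed.

(* The generating functions of overpartitions and of partitions. *)
Definition overgf := diag_sum 1 0 + q ^+ 2 * diag_sum 1 2.

(** An invariant: eliminating [diag_sumq] between [diag_sumB] and [diag_sum_rec] shows that the left
    side does not change with [m]. Unrolling it in steps of 2 yields a partial theta series. *)
Lemma diag_sum1_overgf m : diag_sum 1 m + q ^+ m.+2 * diag_sum 1 m.+2 = overgf.
Proof.
elim: m => [//|m <-].
have := diag_sumB 1 m; have := diag_sum_rec 1 m.+1.
rewrite !exprS !mul1r => -> t1; apply: subr0_eq.
by have := congr1 (fun x => diag_sum 1 m.+1 - diag_sum 1 m - x) (esym t1); rewrite subrr => <-;
  ring.
Qed.

Lemma overgfE : overgf = 1 + 2%:R * q * diag_sum 1 1.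
Proof. rewrite /overgf diag_sum_0 (diag_sum_rec 1 0); ring. Qed.

Definition partgf := diag_sum 0 0 + q ^+ 3 * diag_sum 0 3.

(** With [d = 0] the middle terms of both recurrences disappear and the invariant links [m] to
    [m + 3]; the step 3 is what produces pentagonal exponents. *)
Lemma diag_sum0_partgf m : diag_sum 0 m + q ^+ m.+3 * diag_sum 0 m.+3 = partgf.
Proof.
elim: m => [//|m <-].
have := diag_sumB 0 m; have := diag_sum_rec 0 m.+2.
rewrite !exprS !mul0r !(add0r, addr0) => -> t1; apply: subr0_eq.
by have := congr1 (fun x => diag_sum 0 m.+1 - diag_sum 0 m - x) (esym t1); rewrite subrr => <-;
  ring.
Qed.

Lemma partgfE : partgf = 1 + q * diag_sum 0 1 + q ^+ 2 * diag_sum 0 2.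
Proof. rewrite /partgf diag_sum_0 (diag_sum_rec 0 1); ring. Qed.

Lemma partgf_ge0 n : 0 <= partgf n.
Proof.
by apply: fpsD_ge0 => [m|m]; [|apply: fpsM_ge0 => [l|l]; first exact: fps_qX_ge0];
  apply: diag_sum_ge0.
Qed.

Lemma is_sum_indic (I : eqType) (b : I) : is_sum (fun i => indic (i == b)) 1.
Proof.
exists [:: b]; last by rewrite big_seq1 eqxx.
by split=> // i; rewrite inE; case: (i == b).
Qed.

Lemma gf_qsum (I : eqType) (w e : nat * I -> int) (g : nat -> fps) :
  (forall a, is_gf (fun i => w (a, i)) (fun i => e (a, i)) (g a)) ->
  (forall p, w p != 0 -> 0 <= e p) -> is_gf w (fun p => p.1%:Z + e p) (qsum g).
Proof.
move=> wg e0 M; rewrite qsumE -(big_mkord xpredT (fun b => g b (M - b)%N)).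
under eq_bigr do rewrite -[g _ _]mul1r.
apply: eq_is_sum (is_sum_big _ (fun b => is_sumM (is_sum_indic b) (wg b (M - b)%N))).
move=> [a i] /=; have [w0|/e0 ea0] := eqVneq (w (a, i)) 0.
  rewrite w0 if_same big1 // => b _; have [<-|_] := eqVneq a b.
    by rewrite w0 if_same mulr0.
  by rewrite (_ : indic false = 0) // mul0r.
case: (a%:Z + e (a, i) =P _) => [eM|neM].
  rewrite (bigD1_seq a) ?iota_uniq ?mem_index_iota //=; last by lia.
  have aM : (a <= M)%N by rewrite -lez_nat -eM lerDl.
  rewrite eqxx (_ : indic true = 1) // mul1r ifT; last by rewrite -subzn // -eM; apply/eqP; ring.
  by rewrite big1 ?addr0 // => b ba; rewrite eq_sym (negbTE ba) (_ : indic false = 0) // mul0r.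
rewrite big_nat big1 // => b; case: (a =P b) => [<-|_] bM;
  last by rewrite (_ : indic false = 0) // mul0r.
rewrite ifF ?mulr0 //; apply/eqP => eM; case: neM.
by rewrite eM -PoszD subnKC //; case/andP: bM.
Qed.

Lemma gf_one (e : int -> int) : e 0 = 0 -> is_gf (fun k => indic (k == 0)) e 1.
Proof.
move=> e0 M; rewrite fps1E.
have -> : ((M == 0%N)%:R : int) = (M == 0%N)%:R * 1 by rewrite mulr1.
apply: eq_is_sum (is_sumZ _ (is_sum_indic 0)) => k.
by case: (k =P 0) => [->|]; rewrite ?e0 ?mulr0 ?if_same // mulr1 eqz_nat eq_sym; case: eqP.
Qed.

(** * Partial theta functions *)

Definition ptheta2 (m : nat) :=
  gf (fun k => m1pow k * indic (0 <= k)) (fun k => k * k + m.+1%:Z * k).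
Lemma gf_ptheta2 m :
  is_gf (fun k => m1pow k * indic (0 <= k)) (fun k => k * k + m.+1%:Z * k) (ptheta2 m).
Proof. by apply/gf_spec/gf_ex1 => M; exists M => a /indic_neq0 a0; nia. Qed.

Lemma ptheta2_rec m : ptheta2 m = 1 - q ^+ m.+2 * ptheta2 m.+2.
Proof.
apply: gf_uniq (gf_ptheta2 m) _.
have e0 k : m1pow k * indic (0 <= k) != 0 -> 0 <= k * k + m.+3%:Z * k by move=> /indic_neq0; nia.
have latq : is_gf (fun k => m1pow (k - 1) * indic (0 <= k - 1)) (fun k => k * k + m.+1%:Z * k)
    (q ^+ m.+2 * ptheta2 m.+2).
  apply: (gf_reindex (h := fun k => k - 1) (g := fun k => k + 1)
    (gf_shift m.+2 (gf_ptheta2 m.+2) e0)) => //.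
  - by move=> k; ring.
  - by move=> k _; ring.
  - by move=> k _; rewrite !(intS, PoszD) /=; ring.
have l1 : is_gf (fun k => indic (k == 0)) (fun k => k * k + m.+1%:Z * k) 1.
  by apply: gf_one; rewrite !mulr0.
have := gfD l1 (gfZ (-1) latq); rewrite mulN1r; apply: eq_is_gf => // k.
have -> : m1pow (k - 1) = - m1pow k by rewrite /m1pow; lia.
have [->|k0] := eqVneq k 0; first by [].
have -> : indic (0 <= k - 1) = indic (0 <= k) by rewrite /indic; lia.
by rewrite (_ : indic false = 0) //; ring.
Qed.

Lemma phiN_ptheta2_1 : phiN = 1 - 2%:~R * (q * ptheta2 1).
Proof.
have e0 k : m1pow k * indic (0 <= k) != 0 -> 0 <= k * k + 2%:Z * k by move=> /indic_neq0; nia.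
have latq : is_gf (fun k => m1pow (k - 1) * indic (0 <= k - 1)) (fun k => k * k) (q * ptheta2 1).
  apply: (gf_reindex (h := fun k => k - 1) (g := fun k => k + 1)
    (gf_shift 1 (gf_ptheta2 1) e0)) => //.
  - by move=> k; ring.
  - by move=> k _; ring.
  - by move=> k _ /=; ring.
have l1 : is_gf (fun k => indic (k == 0)) (fun k => k * k) 1 by apply: gf_one.
have := gfD gf_phiN (gfD (gfZ (-1) l1) (gfZ 2 latq)).
move=> /(gf_odd (h := fun i : int => - i)) eq0.
suff : phiN + ((-1)%:~R * 1 + 2%:~R * (q * ptheta2 1)) = 0.
  by move=> eq1; apply: subr0_eq; rewrite -eq1; ring.
apply: eq0; first exact: opprK.
  by move=> i _; ring.
move=> k; rewrite m1powN.
have -> : m1pow (- k - 1) = - m1pow k by rewrite /m1pow; lia.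
have -> : m1pow (k - 1) = - m1pow k by rewrite /m1pow; lia.
rewrite oppr_eq0; have [->|k0] := eqVneq k 0; first by [].
have -> : indic (0 <= - k - 1) = 1 - indic (0 <= k - 1) by rewrite /indic; lia.
by rewrite (_ : indic false = 0) //; ring.
Qed.

Lemma diag_sum1_ptheta2 m : diag_sum 1 m = overgf * ptheta2 m.
Proof.
apply: subr0_eq; move: m.
apply: (fps_contract (f := fun m => diag_sum 1 m - overgf * ptheta2 m)
  (k := fun m => m.+1) (l := fun m => m.+2)) => m.
by rewrite ptheta2_rec -(diag_sum1_overgf m); ring.
Qed.

(** Two expressions for [overgf * ptheta2 1 = diag_sum 1 1] are compared: [overgfE] and the
    splitting of phi(-q) into its two halves. *)
Lemma overgf_phiN : overgf * phiN = 1.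
Proof.
rewrite phiN_ptheta2_1; transitivity (overgf - 2%:~R * q * (overgf * ptheta2 1)); first by ring.
by rewrite -diag_sum1_ptheta2 {1}overgfE; ring.
Qed.

Lemma tri_succ k : tri (k + 1) = tri k + k.
Proof. by have := tri2 (k + 1); have := tri2 k; lia. Qed.

Definition ptheta3 (m : nat) :=
  gf (fun k => m1pow k * indic (0 <= k)) (fun k => 3 * tri (k + 1) + m%:Z * k).
Lemma gf_ptheta3 m :
  is_gf (fun k => m1pow k * indic (0 <= k)) (fun k => 3 * tri (k + 1) + m%:Z * k) (ptheta3 m).
Proof.
apply/gf_spec/gf_ex1 => M; exists M => a /indic_neq0 a0; have := tri2 (a + 1).
have : 0 <= m%:Z * a by apply: mulr_ge0.
by have := sqr_bound a; move: (m%:Z * a) (a * a) => x y; lia.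
Qed.

Lemma ptheta3_exp_ge0 (m : nat) k :
  m1pow k * indic (0 <= k) != 0 -> 0 <= 3 * tri (k + 1) + m%:Z * k.
Proof.
move=> /indic_neq0 k0; apply: addr_ge0; last exact: mulr_ge0.
by have := tri_ge0 (k + 1); lia.
Qed.

Lemma ptheta3_rec m : ptheta3 m = 1 - q ^+ m.+3 * ptheta3 m.+3.
Proof.
apply: gf_uniq (gf_ptheta3 m) _.
have latq : is_gf (fun k => m1pow (k - 1) * indic (0 <= k - 1))
    (fun k => 3 * tri (k + 1) + m%:Z * k) (q ^+ m.+3 * ptheta3 m.+3).
  apply: (gf_reindex (h := fun k => k - 1) (g := fun k => k + 1)
    (gf_shift m.+3 (gf_ptheta3 m.+3) (@ptheta3_exp_ge0 m.+3))) => //.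
  - by move=> k; ring.
  - by move=> k _; ring.
  - by move=> k _; rewrite subrK tri_succ !(intS, PoszD) /=; ring.
have l1 : is_gf (fun k => indic (k == 0)) (fun k => 3 * tri (k + 1) + m%:Z * k) 1.
  by apply: gf_one; rewrite mulr0; have := tri2 (0 + 1); lia.
have := gfD l1 (gfZ (-1) latq); rewrite mulN1r; apply: eq_is_gf => // k.
have -> : m1pow (k - 1) = - m1pow k by rewrite /m1pow; lia.
have [->|k0] := eqVneq k 0; first by [].
have -> : indic (0 <= k - 1) = indic (0 <= k) by rewrite /indic; lia.
by rewrite (_ : indic false = 0) //; ring.
Qed.

Lemma diag_sum0_ptheta3 m : diag_sum 0 m = partgf * ptheta3 m.
Proof.
apply: subr0_eq; move: m.
apply: (fps_contract (f := fun m => diag_sum 0 m - partgf * ptheta3 m) (k := fun m => m.+2)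
  (l := fun m => m.+3)) => m.
by rewrite ptheta3_rec -(diag_sum0_partgf m); ring.
Qed.

(** The indices [- 3 * (k + 1)] and [3 * (k + 1)] give six times the two kinds of pentagonal
    numbers, each forming a partial theta series. *)
Lemma euler6_ptheta3 : euler6 = dil 6 (1 - q * ptheta3 1 - q ^+ 2 * ptheta3 2).
Proof.
have [t1 lt1] : exists s, is_gf (fun j => m1pow j * indic (((j %% 3)%Z == 0) && (j < 0)))
    (fun j => j * j + j) s.
  by apply: gf_ex1 => M; exists M.+1 => a _; have := sqrD_bound a; lia.
have [t2 lt2] : exists s, is_gf (fun j => m1pow j * indic (((j %% 3)%Z == 0) && (0 < j)))
    (fun j => j * j + j) s.
  by apply: gf_ex1 => M; exists M.+1 => a _; have := sqrD_bound a; lia.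
have -> : euler6 = 1 + t1 + t2.
  apply: gf_uniq gf_euler6 _.
  apply: eq_is_gf (gfD (gfD (gf_one (e := fun j => j * j + j) _) lt1) lt2) => // k.
  by have [->|k0] := eqVneq k 0; [|rewrite (_ : indic false = 0) // add0r -mulrDr;
    congr (_ * _); rewrite /indic; lia].
have -> : t1 = - dil 6 (q * ptheta3 1).
  have := gfZ (-1) (gf_dil (isT : (0 < 6)%N) (gf_shift 1 (gf_ptheta3 1) (@ptheta3_exp_ge0 1))).
  rewrite mulN1r; apply: gf_uniq.
  apply: (gf_reindex (h := fun k : int => - 3 * k - 3)
    (g := fun j : int => (- j %/ 3)%Z - 1) lt1).
  - by move=> k; lia.
  - by move=> j /indic_neq0; lia.
  - move=> k; have -> : m1pow (- 3 * k - 3) = - m1pow k by rewrite /m1pow; lia.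
    by rewrite mulN1r -mulNr; congr (_ * _); rewrite /indic; lia.
  - by move=> k _ /=; have := tri2 (k + 1); lia.
have -> : t2 = - dil 6 (q ^+ 2 * ptheta3 2).
  have := gfZ (-1) (gf_dil (isT : (0 < 6)%N) (gf_shift 2 (gf_ptheta3 2) (@ptheta3_exp_ge0 2))).
  rewrite mulN1r; apply: gf_uniq.
  apply: (gf_reindex (h := fun k : int => 3 * k + 3) (g := fun j : int => (j %/ 3)%Z - 1) lt2).
  - by move=> k; lia.
  - by move=> j /indic_neq0; lia.
  - move=> k; have -> : m1pow (3 * k + 3) = - m1pow k by rewrite /m1pow; lia.
    by rewrite mulN1r -mulNr; congr (_ * _); rewrite /indic; lia.
  - by move=> k _ /=; have := tri2 (k + 1); lia.
by rewrite !dilD !dilN dil1.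
Qed.

Lemma euler6_partgf : dil 6 partgf * euler6 = 1.
Proof.
rewrite euler6_ptheta3 -dilM // (_ : partgf * _ =
    partgf - q * (partgf * ptheta3 1) - q ^+ 2 * (partgf * ptheta3 2));
  last by ring.
rewrite -!diag_sum0_ptheta3 {1}partgfE (_ : _ + _ + _ - _ - _ = 1); last by ring.
exact: dil1.
Qed.

(** * Expansions with nonnegative coefficients *)

(** The map (a, b) -> (- 1 - a, - b) carries the negative quadrant to [0 <= a], [0 < b]; the signs
    of [eps] and of [m1pow] both change, so each [b > 0] is counted twice and [b = 0] once. For
    fixed [b], the sum over [a] is a partial theta series. *)
Lemma gf_fold_lambert (c : int -> int) (s : fps) : (forall j, c (- j) = c j) ->
  is_gf (fun p => m1pow p.1 * eps p.1 p.2 * c p.2)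
    (fun p => 3 * p.1 * p.1 + 3 * p.1 + (2 * p.1 + 1) * p.2) s ->
  s = qsum (fun a => ((indic (0 < a%:Z) + 1) * c a%:Z)%:~R * dil 2 (ptheta3 a)).
Proof.
move=> cN ls; pose e (p : int * int) := 3 * p.1 * p.1 + 3 * p.1 + (2 * p.1 + 1) * p.2.
have [sp lsp] : exists s,
    is_gf (fun p => m1pow p.1 * c p.2 * indic ((0 <= p.1) && (0 <= p.2))) e s.
  apply: gf_ex2 => M; exists (8 * M + 8)%N => a b /indic_neq0; rewrite /e /= => h1 h2.
  have := sqr_bound a; have : `|b| <= (2 * a + 1) * b by rewrite mulrC; apply: mul_boundr; lia.
  by move: h2; rewrite -mulrA; move: ((2 * a + 1) * b) (a * a) => x y; lia.
have lsn : is_gf (fun p => m1pow p.1 * c p.2 * indic ((0 <= p.1) && (0 < p.2))) e (s - sp).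
  have := gfD ls (gfZ (-1) lsp); rewrite mulN1r => ls0.
  apply: (gf_reindex (h := fun p : int * int => (- 1 - p.1, - p.2))
    (g := fun p : int * int => (- 1 - p.1, - p.2)) ls0).
  - by move=> [a b] /=; congr (_, _); ring.
  - by move=> [a b] _ /=; congr (_, _); ring.
  - move=> [a b] /=; rewrite cN; have -> : m1pow (- 1 - a) = - m1pow a by rewrite /m1pow; lia.
    rewrite /eps; have -> : (- 1 - a < 0) && (- b < 0) = (0 <= a) && (0 < b) by lia.
    by ring.
  - by move=> [a b] _; rewrite /e /=; ring.
have lp := gfD lsp lsn; rewrite [sp + _]addrC subrK in lp.
have e0 (p : nat * int) :
    (indic (0 < p.1%:Z) + 1) * c p.1%:Z * (m1pow p.2 * indic (0 <= p.2)) != 0 ->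
    0 <= 2%:Z * (3 * tri (p.2 + 1) + p.1%:Z * p.2).
  rewrite mulrA => /indic_neq0 p0; rewrite mulr_ge0 // addr_ge0 //; last exact: mulr_ge0.
  by have := tri_ge0 (p.2 + 1); lia.
pose cc (a : nat) := (indic (0 < a%:Z) + 1) * c a%:Z.
have lqsum : is_gf (fun p : nat * int => cc p.1 * (m1pow p.2 * indic (0 <= p.2)))
    (fun p => p.1%:Z + 2%:Z * (3 * tri (p.2 + 1) + p.1%:Z * p.2))
    (qsum (fun a => (cc a)%:~R * dil 2 (ptheta3 a))).
  apply: (gf_qsum (e := fun p : nat * int => 2%:Z * (3 * tri (p.2 + 1) + p.1%:Z * p.2)) _ e0).
  move=> a; apply: (gfZ (cc a)); exact: (gf_dil (isT : (0 < 2)%N) (gf_ptheta3 a)).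
apply: gf_uniq lqsum.
apply: (gf_reindex (h := fun p : nat * int => (p.2, p.1%:Z))
  (g := fun p : int * int => (absz p.2, p.1)) lp).
- by move=> [a b].
- move=> [a b] /= h; congr (_, _); apply/gez0_abs; apply: contraNT h => b0.
  have b1 : (0 <= b) = false by apply: negbTE.
  have b2 : (0 < b) = false by apply: contraNF b0; apply: ltW.
  by rewrite b1 b2 !andbF (_ : indic false = 0) // !mulr0.
- move=> [a b] /=; rewrite andbT /cc.
  have -> : indic ((0 <= b) && (0 < a%:Z)) = indic (0 <= b) * indic (0 < a%:Z).
    by case: (0 <= b); case: (0 < a%:Z).
  by ring.
- by move=> [a b] _; rewrite /e /=; have := tri2 (b + 1); lia.
Qed.

Definition appell := gf (fun p => m1pow p.1 * eps p.1 p.2)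
  (fun p => 3 * p.1 * p.1 + 3 * p.1 + (2 * p.1 + 1) * p.2).
Lemma gf_appell : is_gf (fun p => m1pow p.1 * eps p.1 p.2)
  (fun p => 3 * p.1 * p.1 + 3 * p.1 + (2 * p.1 + 1) * p.2) appell.
Proof.
apply/gf_spec/gf_ex2 => M; exists (8 * M + 8)%N => a b /indicB_neq0 /=.
move=> h1 h2; have := sqrD_bound a.
have : `|b| <= (2 * a + 1) * b by rewrite mulrC; apply: mul_boundr; lia.
by move: h2; rewrite -mulrA; move: ((2 * a + 1) * b) (a * a) => x y; lia.
Qed.

Lemma appell3_dil : appell3 = dil 3 appell.
Proof.
apply: gf_uniq (gf_dil (isT : (0 < 3)%N) gf_appell).
by apply: eq_is_gf gf_appell3 => // -[a b] _ /=; ring.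
Qed.

Lemma partgf_appell : dil 2 partgf * appell =
  qsum (fun a => (indic (0 < a%:Z) + 1)%:~R * dil 2 (diag_sum 0 a)).
Proof.
have ll : is_gf (fun p => m1pow p.1 * eps p.1 p.2 * 1)
    (fun p => 3 * p.1 * p.1 + 3 * p.1 + (2 * p.1 + 1) * p.2) appell.
  by apply: eq_is_gf gf_appell => // p; rewrite mulr1.
have lamE := gf_fold_lambert (c := fun=> 1) (fun=> erefl) ll.
rewrite {}lamE qsum_mull; apply: eq_qsum => a.
by rewrite mulr1 mulrCA -dilM // -diag_sum0_ptheta3.
Qed.

(** Replacing q by q^3 in [psi_sq] gives exactly the terms of [appell] whose second index is a
    multiple of 3. Hence both expand over the same series and can be compared term by term. *)
Lemma partgf_psi_sq3 : dil 2 partgf * dil 3 psi_sq =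
  qsum (fun a =>
    ((indic (0 < a%:Z) + 1) * indic ((a%:Z %% 3)%Z == 0))%:~R * dil 2 (diag_sum 0 a)).
Proof.
have ll : is_gf (fun p => m1pow p.1 * eps p.1 p.2 * indic ((p.2 %% 3)%Z == 0))
    (fun p => 3 * p.1 * p.1 + 3 * p.1 + (2 * p.1 + 1) * p.2) (dil 3 psi_sq).
  pose h (p : int * int) := (p.1, 3 * p.2); pose g (p : int * int) := (p.1, (p.2 %/ 3)%Z).
  have hK : cancel h g by move=> [a b]; congr (_, _) => /=; lia.
  apply: (iffRL (gf_bij _ _ hK _)).
    by move=> [a b] /indic_neq0 /= h0; congr (_, _) => /=; lia.
  apply: eq_is_gf (gf_dil (isT : (0 < 3)%N) gf_psi_sq) => [[a b]|[a b] _] /=; last by ring.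
  have -> : (3 * b %% 3)%Z == 0 by lia.
  by rewrite (_ : indic true = 1) // mulr1; congr (_ * _); rewrite /eps /indic; lia.
have c3N (j : int) : indic ((- j %% 3)%Z == 0) = indic ((j %% 3)%Z == 0) by rewrite /indic; lia.
have X3E := gf_fold_lambert (c := fun j => indic ((j %% 3)%Z == 0)) c3N ll.
rewrite {}X3E qsum_mull; apply: eq_qsum => a.
by rewrite mulrCA -dilM // -diag_sum0_ptheta3.
Qed.

Lemma partgf_appell_ge0 n : 0 <= (dil 2 partgf * appell) n.
Proof.
rewrite partgf_appell; apply: qsum_ge0 => a m; rewrite fps_intE mulr_ge0 //.
by apply: dil_ge0 => l; apply: diag_sum_ge0.
Qed.

Lemma partgf_appell_psi_sq3 n : (dil 2 partgf * dil 3 psi_sq) n <= 3 * (dil 2 partgf * appell) n.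
Proof.
rewrite partgf_appell partgf_psi_sq3 !qsumE mulr_sumr; apply: ler_sum => a _; rewrite !fps_intE.
have : 0 <= dil 2 (diag_sum 0 a) (n - a)%N by apply: dil_ge0 => l; apply: diag_sum_ge0.
by rewrite mulrA => t0; apply: ler_wpM2r => //; rewrite /indic; lia.
Qed.

(** The alternating Lambert form hides the sign; the square of [Psi] shows it. *)
Lemma psi_sq_ge0 n : 0 <= psi_sq n.
Proof.
have : 0 <= (Psi * Psi) n by apply: fpsM_ge0 => m; apply: gf_ge0 gf_Psi _.
by rewrite Psi_sqr fps_intE; lia.
Qed.

Lemma tri_mod3 a : (tri a %% 3)%Z = indic ((a %% 3)%Z == 2).
Proof.
have := tri2 a; have [k [r [-> r3]]] : exists k r, a = 3 * k + r /\ [\/ r = 0, r = 1 | r = 2].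
  exists (a %/ 3)%Z, (a %% 3)%Z; split; first by rewrite mulrC -divz_eq.
  have [|[|]] : (a %% 3)%Z = 0 \/ (a %% 3)%Z = 1 \/ (a %% 3)%Z = 2 by lia.
  - by constructor 1.
  - by constructor 2.
  - by constructor 3.
by rewrite /indic; case: r3 => ->; move: (tri _) => t; lia.
Qed.

(** Triangular numbers are 0 or 1 modulo 3, so a sum of two that is 2 modulo 3 forces both indices
    to have the form 3a - 1, where tri(3a - 1) = 9 tri(a) + 1. *)
Lemma trisect2_psi_sq : trisect 2 psi_sq = dil 3 psi_sq.
Proof.
have lPP := gfM gf_Psi gf_Psi (fun i _ => tri_ge0 i) (fun i _ => tri_ge0 i).
suff PP : trisect 2 (Psi * Psi) = dil 3 (Psi * Psi).
  apply: fpsP => n; have := congr1 (fun f : fps => f n) PP.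
  by rewrite Psi_sqr dilZ /= fps_intE trisectE fps_intE -trisectE; lia.
apply: fpsP => M; rewrite trisectE.
apply: is_sum_uniq (gf_dil (isT : (0 < 3)%N) lPP M).
have := lPP (3 * M + 2)%N; rewrite (is_sum_bij (J := (int * int)%type) _
  (h := fun p => (3 * p.1 - 1, 3 * p.2 - 1))
  (g := fun p => (((p.1 + 1) %/ 3)%Z, ((p.2 + 1) %/ 3)%Z))) /=.
- apply: eq_is_sum => -[a b] /=; congr (if _ then _ else _).
  have := tri2 (3 * a - 1); have := tri2 (3 * b - 1); have := tri2 a; have := tri2 b; lia.
- by move=> [a b] /=; congr (_, _); lia.
- move=> [a b] /=; case: (tri a + tri b =P _) => // ab _.
  by have := tri_mod3 a; have := tri_mod3 b; rewrite /indic => h1 h2; congr (_, _); lia.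
Qed.

(** * The rank generating functions *)

(* When [eta m + eta (m + 1) = zeta ^ m + zeta ^ (- m)] for [m > 0], this is the rank
   generating function at [u = zeta], by [total_rank_gf]. *)
Definition rank_gf (eta : int -> int) : fps :=
  1 + 2%:~R * (q * qsum (fun m => (eta m.+1%:Z)%:~R * (diag_sum 1 m.+1 - q * diag_sum 1 m.+2))).

(** Since phi(-q) inverts [overgf], it turns every [diag_sum 1 m] into a partial theta series, and
    collecting equal exponents leaves first differences of [eta]. The factor 2 is spent on a copy
    reflected to the negative quadrant; as [eta 1 = 1], the terms on [b = 0] cancel against phi(-q)
    - 1. *)
Lemma gf_phiN_rank_gf (eta : int -> int) : eta 1 = 1 ->
  is_gf (fun p : int * int => - (m1pow p.1 *
      (indic ((0 < p.1) && (0 < p.2)) * (eta (p.2 + 1) - eta p.2) +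
       indic ((p.1 < 0) && (p.2 < 0)) * (eta (1 - p.2) - eta (- p.2)))))
    (fun p => p.1 * p.1 + p.1 * p.2) (phiN * rank_gf eta - 1).
Proof.
have indic_gt0 (x : int) : x != 0 -> indic (0 < x) = 1 - indic (x < 0) by rewrite /indic; lia.
move=> eta1; pose e (p : int * int) := p.1 * p.1 + p.1 * p.2.
pose H1 := q * qsum (fun m => (eta m.+1%:Z)%:~R * ptheta2 m.+1).
pose H2 := q * qsum (fun m => (eta m.+1%:Z)%:~R * (q * ptheta2 m.+2)).
have -> : phiN * rank_gf eta - 1 = (phiN * 1 - 1 * 1) + (H1 - H2) + (H1 - H2).
  have C1 m : phiN * diag_sum 1 m = ptheta2 m.
    by rewrite diag_sum1_ptheta2 mulrA [phiN * overgf]mulrC overgf_phiN mul1r.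
  have -> : H1 - H2 =
      q * (phiN * qsum (fun m => (eta m.+1%:Z)%:~R * (diag_sum 1 m.+1 - q * diag_sum 1 m.+2))).
    rewrite /H1 /H2 -mulrBr; congr (_ * _); rewrite -mulN1r !qsum_mull qsumD; apply: eq_qsum => m.
    by rewrite -!C1; ring.
  by rewrite /rank_gf; ring.
have e0 (m : nat) k : m1pow k * indic (0 <= k) != 0 -> 0 <= k * k + m.+1%:Z * k.
  by move=> /indic_neq0; nia.
have ex_quad (w : int * int -> int) :
    exists s, is_gf (fun p => w p * indic ((0 < p.1) && (0 <= p.2))) e s.
  apply: gf_ex2 => M; exists (8 * M + 8)%N => a b /indic_neq0; rewrite /e /= => h1 h2.
  have : `|b| <= b * a by apply: mul_boundr; lia.
  by have := sqr_bound a; move: h2; rewrite mulrC [b * a]mulrC; move: (a * a) (a * b) => x y; lia.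
have lH1 : is_gf (fun p => - (m1pow p.1 * eta (p.2 + 1)) * indic ((0 < p.1) && (0 <= p.2))) e H1.
  have [s ls] := ex_quad (fun p => - (m1pow p.1 * eta (p.2 + 1))).
  pose w (p : nat * int) := eta p.1.+1%:Z * (m1pow p.2 * indic (0 <= p.2)).
  have w0 p : w p != 0 -> 0 <= p.2 * p.2 + p.1.+2%:Z * p.2.
    by rewrite /w mulrA => /indic_neq0 p0; apply: addr_ge0; apply: mulr_ge0.
  have lqsum : is_gf w (fun p => p.1%:Z + (p.2 * p.2 + p.1.+2%:Z * p.2))
      (qsum (fun m => (eta m.+1%:Z)%:~R * ptheta2 m.+1)).
    apply: (gf_qsum (e := fun p : nat * int => p.2 * p.2 + p.1.+2%:Z * p.2) _ w0) => m.
    exact: (gfZ (eta m.+1%:Z) (gf_ptheta2 m.+1)).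
  have lq : is_gf w (fun p => p.1%:Z + (p.2 * p.2 + p.1.+2%:Z * p.2) + 1) H1.
    by apply: (gf_shift 1 lqsum) => p /w0 p0; apply: addr_ge0.
  suff <- : s = H1 by [].
  apply: gf_uniq lq.
  apply: (gf_reindex (h := fun p : nat * int => (p.2 + 1, p.1%:Z))
    (g := fun p : int * int => (absz p.2, p.1 - 1)) ls).
  - by move=> [a b] /=; congr (_, _); ring.
  - by move=> [a b] /indic_neq0 /= /andP[_ b0]; rewrite gez0_abs // subrK.
  - move=> [a b]; rewrite /w /= andbT m1powS (_ : 0 < b + 1 = (0 <= b)); last by lia.
    by rewrite (_ : a%:Z + 1 = a.+1%:Z); [ring | lia].
  - by move=> [a b] _; rewrite /e /= (_ : a.+2%:Z = a%:Z + 2); [ring | lia].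
have lH2 :
    is_gf (fun p => - (m1pow p.1 * eta p.2 * indic (0 < p.2)) * indic ((0 < p.1) &&
      (0 <= p.2))) e H2.
  have [s ls] := ex_quad (fun p => - (m1pow p.1 * eta p.2 * indic (0 < p.2))).
  pose w (p : nat * int) := eta p.1.+1%:Z * (m1pow p.2 * indic (0 <= p.2)).
  have w0 p : w p != 0 -> 0 <= p.2 * p.2 + p.1.+3%:Z * p.2 + 1.
    by rewrite /w mulrA => /indic_neq0 p0; rewrite !addr_ge0 // mulr_ge0.
  have lqsum : is_gf w (fun p => p.1%:Z + (p.2 * p.2 + p.1.+3%:Z * p.2 + 1))
      (qsum (fun m => (eta m.+1%:Z)%:~R * (q * ptheta2 m.+2))).
    apply: (gf_qsum (e := fun p : nat * int => p.2 * p.2 + p.1.+3%:Z * p.2 + 1) _ w0) => m.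
    exact: (gfZ (eta m.+1%:Z) (gf_shift 1 (gf_ptheta2 m.+2) (e0 m.+2))).
  have lq : is_gf w (fun p => p.1%:Z + (p.2 * p.2 + p.1.+3%:Z * p.2 + 1) + 1) H2.
    by apply: (gf_shift 1 lqsum) => p /w0 p0; apply: addr_ge0.
  suff <- : s = H2 by [].
  apply: gf_uniq lq.
  apply: (gf_reindex (h := fun p : nat * int => (p.2 + 1, p.1%:Z + 1))
    (g := fun p : int * int => ((absz p.2).-1, p.1 - 1)) ls).
  - by move=> [a b] /=; congr (_, _); lia.
  - move=> [a b] /= h; congr (_, _); first by ring.
    suff : 0 < b by lia.
    apply: contraNT h => /negbTE ->.
    by rewrite (_ : indic false = 0) // !(mulr0, oppr0, mul0r).
  - move=> [a b]; rewrite /w /= m1powS (_ : 0 < a%:Z + 1 = true); last by lia.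
    rewrite (_ : 0 <= a%:Z + 1 = true); last by lia.
    rewrite andbT (_ : 0 < b + 1 = (0 <= b)); last by lia.
    rewrite (_ : a%:Z + 1 = a.+1%:Z); last by lia.
    by rewrite (_ : indic true = 1) //; ring.
  - by move=> [a b] _; rewrite /e /= (_ : a.+3%:Z = a%:Z + 3); [ring | lia].
have lphi : is_gf (fun p => m1pow p.1 * indic (p.2 == 0)) e (phiN * 1).
  have l1 : is_gf (fun k : int => indic (k == 0)) (fun=> 0) 1 by apply: gf_one.
  apply: eq_is_gf (gfM gf_phiN l1 _ _) => //; last by move=> i _; nia.
  by move=> [a b] /= /indic_neq0 /eqP ->; rewrite /e /= mulr0.
have lone : is_gf (fun p => indic (p.1 == 0) * indic (p.2 == 0)) e (1 * 1).
  have l1 : is_gf (fun k : int => indic (k == 0)) (fun=> 0) 1 by apply: gf_one.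
  apply: eq_is_gf (gfM l1 l1 _ _) => //.
  by move=> [a b] /=; rewrite mulrC => /indic_neq0 /eqP ->; rewrite /e /= !mul0r.
have lH := gfD lH1 (gfZ (-1) lH2).
rewrite mulN1r in lH.
have lHN : is_gf (fun p => - (m1pow p.1 * eta (1 - p.2)) * indic ((p.1 < 0) && (p.2 <= 0)) +
    m1pow p.1 * eta (- p.2) * indic (p.2 < 0) * indic ((p.1 < 0) && (p.2 <= 0))) e (H1 - H2).
  apply: (gf_reindex (h := fun p : int * int => (- p.1, - p.2))
    (g := fun p : int * int => (- p.1, - p.2)) lH).
  - by move=> [a b] /=; rewrite !opprK.
  - by move=> [a b] _ /=; rewrite !opprK.
  - move=> [a b] /=; rewrite m1powN !oppr_gt0 oppr_ge0 [- b + 1]addrC; ring.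
  - by move=> [a b] _; rewrite /e /=; ring.
have := gfD (gfD (gfD lphi (gfZ (-1) lone)) lH) lHN; rewrite mulN1r; apply: eq_is_gf => //.
move=> [a b] /=; case: (ltrgtP b 0) => [b0|b0|->]; rewrite !(andbT, andbF).
- by rewrite (_ : indic true = 1) // (_ : indic false = 0) // [b + 1]addrC; ring.
- by rewrite (_ : indic true = 1) // (_ : indic false = 0) // ; ring.
rewrite (_ : indic true = 1) // (_ : indic false = 0) // add0r subr0 eta1.
rewrite !(mul0r, mulr0, mulr1, addr0, oppr0); have [->|a0] := eqVneq a 0; first by [].
by rewrite indic_gt0 // (_ : indic false = 0) //; ring.
Qed.

(* Chosen so that [eta m + eta (m + 1)] is 2 cos(2 pi m / 3), resp. 2 cos(pi m / 3). *)
Definition eta3 (m : int) : int := 1 - 3 * indic ((m %% 3)%Z == 2).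
Definition eta6 (m : int) : int := indic ((m %% 6)%Z == 0) + indic ((m %% 6)%Z == 1)
  - indic ((m %% 6)%Z == 3) - indic ((m %% 6)%Z == 4).

Lemma modz_cases (d : nat) (x : int) : (0 < d)%N ->
  exists k (r : nat), (r < d)%N /\ x = k * d%:Z + r%:Z.
Proof.
move=> d0; exists (x %/ d%:Z)%Z, (absz (x %% d%:Z)%Z); rewrite gez0_abs ?modz_ge0 //; last by lia.
by split; [have := @ltz_pmod x d%:Z; have := @modz_ge0 x d%:Z; lia | exact: divz_eq].
Qed.

Lemma modz_period (k d r s : int) :
  [/\ ((k * d + r) %% d)%Z = (r %% d)%Z, ((k * d + r + s) %% d)%Z = ((r + s) %% d)%Z,
      (- (k * d + r) %% d)%Z = (- r %% d)%Z
    & ((- (k * d + r) + s) %% d)%Z = ((- r + s) %% d)%Z].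
Proof. by rewrite opprD -mulNr -!addrA !modzMDl. Qed.

Lemma gf_lambert_odd_mod2 :
  is_gf (fun p => m1pow p.1 * eps1 p.1 p.2 * (chi3 p.2 * indic ((p.2 %% 2)%Z == 1)))
  (fun p => p.1 * p.1 + p.1 * p.2) lambert_odd.
Proof.
have lLo := gf_lambert_odd.
pose h (p : int * int) := (p.1, 2 * p.2 + 1).
pose g (p : int * int) := (p.1, (p.2 %/ 2)%Z).
have hK : cancel h g by move=> [a b]; congr (_, _) => /=; lia.
apply: (iffRL (gf_bij _ _ hK _)).
  by move=> [a b] /=; rewrite mulrA => /indic_neq0 h0; congr (_, _) => /=; lia.
apply: eq_is_gf lLo => [[a b]|//] /=.
have -> : ((2 * b + 1) %% 2)%Z == 1 by lia.
have -> : eps1 a (2 * b + 1) = eps2 a b by rewrite /eps1 /eps2 /indic; lia.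
by rewrite (_ : indic true = 1) //; ring.
Qed.

Lemma gf_lambert_even_mod2 :
  is_gf (fun p => - (m1pow p.1 * eps1 p.1 p.2 * (chi3 p.2 * indic ((p.2 %% 2)%Z == 0))))
  (fun p => p.1 * p.1 + p.1 * p.2) lambert_even.
Proof.
have lLe := gf_lambert_even.
pose h (p : int * int) := (p.1, 2 * p.2).
pose g (p : int * int) := (p.1, (p.2 %/ 2)%Z).
have hK : cancel h g by move=> [a b]; congr (_, _) => /=; lia.
apply: (iffRL (gf_bij _ _ hK _)).
  by move=> [a b] /=; rewrite oppr_eq0 mulrA => /indic_neq0 h0; congr (_, _) => /=; lia.
apply: eq_is_gf lLe => [[a b]|[a b] _] /=; last by ring.
have -> : (2 * b %% 2)%Z == 0 by lia.
have -> : eps1 a (2 * b) = eps1 a b by rewrite /eps1 /indic; lia.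
have -> : chi3 (2 * b) = - chi3 b by rewrite /chi3 /indic; lia.
by rewrite (_ : indic true = 1) //; ring.
Qed.

(** The first difference of [eta3] is -3 [chi3], while that of [eta6] is [- chi3] at odd and [chi3]
    at even arguments. This accounts for the factor 3 and for the relative sign of the two
    halves. *)
Lemma phiN_rank_gf3 : phiN * rank_gf eta3 = 1 + 3%:~R * (lambert_odd - lambert_even).
Proof.
have d3 (b : int) : eta3 (b + 1) - eta3 b = - 3 * chi3 b by rewrite /eta3 /chi3 /indic; lia.
have d3N (b : int) : eta3 (1 - b) - eta3 (- b) = 3 * chi3 b by rewrite /eta3 /chi3 /indic; lia.
have l1 := gfZ 3 (gfD gf_lambert_odd_mod2 (gfZ (-1) gf_lambert_even_mod2)).
rewrite mulN1r in l1; apply/eqP; rewrite -subr_eq0 opprD addrA subr_eq0; apply/eqP.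
apply: gf_uniq l1; apply: eq_is_gf (gf_phiN_rank_gf (eta := eta3) erefl) => // -[a b] /=.
rewrite d3 d3N /eps1 -/(chi3 b).
have -> : indic ((b %% 2)%Z == 0) = 1 - indic ((b %% 2)%Z == 1) by rewrite /indic; lia.
by ring.
Qed.

Lemma phiN_rank_gf6 : phiN * rank_gf eta6 = 1 + (lambert_odd + lambert_even).
Proof.
have d6 (b : int) : eta6 (b + 1) - eta6 b = - chi3 b * (2 * indic ((b %% 2)%Z == 1) - 1).
  have [k [r [r6 ->]]] := modz_cases b (isT : (0 < 6)%N).
  have [E1 E2 _ _] := modz_period k 6%N r 1.
  have [F _ _ _] := modz_period (k * 2) 3%N r 1; rewrite -mulrA in F.
  have [G _ _ _] := modz_period (k * 3) 2%N r 1; rewrite -mulrA in G.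
  rewrite /eta6 /chi3 E1 E2 F G {E1 E2 F G}.
  by case: r r6 => [|[|[|[|[|[|]]]]]].
have d6N (b : int) : eta6 (1 - b) - eta6 (- b) = chi3 b * (2 * indic ((b %% 2)%Z == 1) - 1).
  have [k [r [r6 ->]]] := modz_cases b (isT : (0 < 6)%N).
  have [_ _ E3 E4] := modz_period k 6%N r 1.
  have [F _ _ _] := modz_period (k * 2) 3%N r 1; rewrite -mulrA in F.
  have [G _ _ _] := modz_period (k * 3) 2%N r 1; rewrite -mulrA in G.
  rewrite [1 - _]addrC /eta6 /chi3 E3 E4 F G {E3 E4 F G}.
  by case: r r6 => [|[|[|[|[|[|]]]]]].
have l1 := gfD gf_lambert_odd_mod2 gf_lambert_even_mod2.
apply/eqP; rewrite -subr_eq0 opprD addrA subr_eq0; apply/eqP.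
apply: gf_uniq l1; apply: eq_is_gf (gf_phiN_rank_gf (eta := eta6) erefl) => // -[a b] /=.
rewrite d6 d6N /eps1 -/(chi3 b).
have -> : indic ((b %% 2)%Z == 0) = 1 - indic ((b %% 2)%Z == 1) by rewrite /indic; lia.
by ring.
Qed.

(** With J = [euler_cube_q2], the odd evaluation yields 2 J and the even one J plus the [appell3]
    term. Their difference serves the cube root; their sum, which is three times what is wanted,
    serves the sixth root. *)
Lemma rank_gf3E : rank_gf eta3 = dil 6 partgf * (psi_sq - 3%:~R * (q ^+ 2 * appell3)).
Proof.
suff RE : euler6 * rank_gf eta3 = psi_sq - 3%:~R * (q ^+ 2 * appell3).
  by rewrite -RE mulrA euler6_partgf mul1r.
apply: (@fps_mulIf phiN); first by rewrite phiN_0.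
have lambert_odd_E := euler6_lambert_odd; have lambert_even_E := euler6_lambert_even.
rewrite (_ : phiN * (euler6 * rank_gf eta3) = euler6 * (phiN * rank_gf eta3)); last by ring.
rewrite phiN_rank_gf3 (_ : phiN * _ = phiN * psi_sq - 3%:~R * (q ^+ 2 * (phiN * appell3)));
  last by ring.
rewrite phiN_psi_sq.
have -> : euler6 * (1 + 3%:~R * (lambert_odd - lambert_even)) =
    (2%:~R * euler6 + 3%:~R * (euler6 * lambert_odd))
  - (euler6 + 3%:~R * (euler6 * lambert_even)) by ring.
by rewrite lambert_odd_E lambert_even_E; ring.
Qed.

Lemma rank_gf6E : rank_gf eta6 = dil 6 partgf * (psi_sq + q ^+ 2 * appell3).
Proof.
suff RE : euler6 * rank_gf eta6 = psi_sq + q ^+ 2 * appell3.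
  by rewrite -RE mulrA euler6_partgf mul1r.
apply: (@fps_mulIf (3%:~R * phiN)).
  by rewrite fps_intE phiN_0.
have lambert_odd_E := euler6_lambert_odd; have lambert_even_E := euler6_lambert_even.
rewrite (_ : 3%:~R * phiN * (euler6 * rank_gf eta6) = 3%:~R * euler6 * (phiN * rank_gf eta6));
  last by ring.
rewrite phiN_rank_gf6 (_ : 3%:~R * phiN * _ =
    3%:~R * (phiN * psi_sq) + 3%:~R * (q ^+ 2 * (phiN * appell3)));
  last by ring.
rewrite phiN_psi_sq.
have -> : 3%:~R * euler6 * (1 + (lambert_odd + lambert_even)) =
    (2%:~R * euler6 + 3%:~R * (euler6 * lambert_odd))
  + (euler6 + 3%:~R * (euler6 * lambert_even)) by ring.
by rewrite lambert_odd_E lambert_even_E; ring.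
Qed.

Lemma rank_gf6_ge0 n : 0 <= rank_gf eta6 n.
Proof.
rewrite rank_gf6E appell3_dil mulrDr (_ : dil 6 partgf = dil 3 (dil 2 partgf));
  last by rewrite dil_dil.
apply: fpsD_ge0 => [m|m].
  by apply: fpsM_ge0 => // l; [do 2!apply: dil_ge0 => {}l; apply: partgf_ge0|apply: psi_sq_ge0].
rewrite mulrCA -dilM //; apply: fpsM_ge0 => l; first exact: fps_qX_ge0.
by apply: dil_ge0 => k; apply: partgf_appell_ge0.
Qed.

Lemma trisect_rank_gf3 r : (r < 3)%N ->
  trisect r (rank_gf eta3) =
    dil 2 partgf * (trisect r psi_sq - 3%:~R * trisect r (q ^+ 2 * dil 3 appell)).
Proof.
move=> r3; rewrite rank_gf3E appell3_dil (_ : dil 6 partgf = dil 3 (dil 2 partgf));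
  last by rewrite dil_dil.
rewrite trisect_mul //; congr (_ * _); apply: fpsP => n.
by rewrite trisectE !fpsBE !fps_intE !trisectE.
Qed.

Lemma rank_gf3_ge0 r n : (r < 2)%N -> 0 <= rank_gf eta3 (3 * n + r)%N.
Proof.
move=> r2; rewrite -trisectE trisect_rank_gf3; last by apply: ltn_trans r2 _.
have -> : trisect r (q ^+ 2 * dil 3 appell) = 0.
  apply: fpsP => m; rewrite trisectE fps_qXM dilE fps0E; case: ifP => // mr.
  by rewrite ifF //; lia.
rewrite mulr0 subr0; apply: fpsM_ge0 => [l|l]; last by rewrite trisectE psi_sq_ge0.
by apply: dil_ge0 => k; apply: partgf_ge0.
Qed.

Lemma rank_gf3_le0 n : rank_gf eta3 (3 * n + 2)%N <= 0.
Proof.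
rewrite -trisectE trisect_rank_gf3 // trisect2_psi_sq.
have -> : trisect 2 (q ^+ 2 * dil 3 appell) = appell.
  apply: fpsP => m; rewrite trisectE fps_qXM addnK dilE.
  by rewrite leq_addl dvdn_mulr // mulKn.
rewrite mulrBr (mulrCA _ 3%:~R) fpsBE fps_intE subr_le0.
exact: partgf_appell_psi_sq3.
Qed.

(** * Enumeration of overpartitions *)

(* The overpartitions of [n] into [l] parts at most [k + 1] without overlined [k + 1]:
   exactly what may follow a first part [k + 1], overlined or not. *)
Fixpoint tails (k : nat) : nat -> nat -> seq (seq (nat * bool)) :=
  if k is k'.+1 then
    fix T (l n : nat) : seq (seq (nat * bool)) :=
      if l is l'.+1 then
        tails k' l n ++
        (if (k < n.+1)%N then [seq (k, true) :: s | s <- tails k' l' (n - k)] else [::]) ++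
        (if (k < n)%N then [seq (k.+1, false) :: s | s <- T l' (n - k.+1)%N] else [::])
      else if n == 0%N then [:: [::]] else [::]
  else fun l n => if n == l then [:: nseq l (1%N, false)] else [::].

Definition in_box (k l n : nat) (s : seq (nat * bool)) : bool :=
  [&& size s == l, sumn (parts s) == n,
      all (fun x => (0 < x.1 <= k.+1)%N && (x.2 ==> (x.1 != k.+1))) s,
      sorted geq (parts s)
    & pairwise (fun x y => y.2 ==> (x.1 != y.1)) s].

(** Whatever the flag of [p], the rest of the list only knows that its parts are at most [p] and
    that no further copy of [p] is overlined: this is the box of index [p.-1]. *)
Lemma in_box_cons k l n p b s : in_box k l.+1 n ((p, b) :: s) =
  [&& (0 < p <= k.+1)%N, b ==> (p != k.+1), (p <= n)%N & in_box p.-1 l (n - p) s].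
Proof.
rewrite /in_box /= eqSS; case: p => [|p] /=; first by rewrite !andbF.
have geq_trans : transitive geq by move=> a c d ca ad; apply: leq_trans ad ca.
rewrite (path_sortedE geq_trans).
have -> : (p.+1 + sumn (parts s) == n)%N = (p.+1 <= n)%N && (sumn (parts s) == n - p.+1)%N.
  by lia.
case: (size s == l) => //=; last by rewrite !andbF.
case pk: (p < k.+1)%N => //=; last by rewrite andbF.
case: (b ==> _) => //=; last by rewrite andbF.
case: (p < n)%N => //=; case: (sumn _ == _) => //=.
case sp: (sorted geq (parts s)) => /=; last by rewrite !andbF.
case: (pairwise _ s) => /=; last by rewrite !andbF.
rewrite !andbT; rewrite /parts /unzip1 all_map -!all_predI.
apply: eq_all => -[x c] /=; case: c => /=; rewrite ?andbT.
  by case: (ltngtP x p.+1) => xp; rewrite ?andbF ?andbT //=; lia.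
by lia.
Qed.

Lemma mem_tails k l n s : (s \in tails k l n) = in_box k l n s.
Proof.
elim: k l n s => [|k IHk] l n s.
  rewrite /=; have -> : in_box 0 l n s = (s == nseq l (1%N, false)) && (n == l).
    apply/idP/idP => [/and5P[/eqP sl /eqP sn s1 _ _]|/andP[/eqP-> /eqP->]].
      have sE : s = nseq l (1%N, false).
        by rewrite -sl; apply/all_pred1P; apply: sub_all s1 => -[[|[|x]] []].
      by move: sn; rewrite sE eqxx /parts /unzip1 map_nseq sumn_nseq /=; lia.
    rewrite /in_box size_nseq eqxx /parts /unzip1 map_nseq sumn_nseq mul1n eqxx /=.
    rewrite all_nseq orbT /=; elim: l => //= l /andP[sl pl].
    rewrite pl all_nseq /= orbT !andbT; case: l sl {pl} => //=.
  by case: eqP => _; rewrite ?inE ?andbT ?andbF.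
elim: l n s => [|l IHl] n s.
  rewrite /=; case: s => [|x s]; last by case: ifP.
  by rewrite /in_box /=; case: n.
rewrite [tails _ _ _]/= !mem_cat IHk.
case: s => [|[p b] s].
  rewrite {1}/in_box /=; apply/negbTE; rewrite negb_or.
  by apply/andP; split; case: ifP => // _; apply/mapP => -[].
have mem_map_cons y (t : seq (seq (nat * bool))) :
    ((p, b) :: s \in [seq y :: u | u <- t]) = ((p, b) == y) && (s \in t).
  apply/mapP/andP => [[u ut [-> ->]]|[/eqP<- st]]; first by [].
  by exists s.
have mem_if (c : bool) y (t : seq (seq (nat * bool))) :
    ((p, b) :: s \in (if c then [seq y :: u | u <- t] else [::])) =
    [&& c, (p, b) == y & s \in t].
  by case: c; rewrite ?mem_map_cons.
rewrite !mem_if IHk -/(tails k.+1 l (n - k.+2)) IHl !in_box_cons !xpair_eqE.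
move=> {mem_map_cons mem_if}; case: (ltngtP p k.+1) => [pk|pk|->] /=.
- have -> : (p == k.+2) = false by lia.
  have -> : (p <= k.+2)%N by lia.
  by rewrite !andbF /= !implybT orbF.
- rewrite !andbF /=; case: (p =P k.+2) => [->|pk2] /=.
    by rewrite leqnn implybF; case: b; rewrite ?andbF.
  have -> : (p <= k.+2)%N = false by lia.
  by rewrite !andbF.
have -> : (k.+1 == k.+2) = false by lia.
have -> : (k.+1 <= k.+2)%N by lia.
rewrite !andbF orbF implybT implybF ltnS /=.
by case: b => /=; rewrite ?andbF ?orbF.
Qed.

Lemma uniq_tails k l n : uniq (tails k l n).
Proof.
elim: k l n => [|k IHk] l n /=; first by case: ifP.
have uniq_map y (t : seq (seq (nat * bool))) : uniq [seq y :: u | u <- t] = uniq t.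
  by rewrite map_inj_uniq // => u v [].
elim: l n => [|l IHl] n; first by case: ifP.
rewrite !cat_uniq IHk /= has_cat negb_or; apply/and3P; split.
- apply/andP; split; case: ifP => // kn; apply/hasPn => _ /mapP[s _ ->];
    by rewrite mem_tails in_box_cons ?eqxx ?ltnn ?andbF.
- by case: ifP => // _; rewrite uniq_map.
- rewrite andbC; case: (k.+1 < n)%N => //=; rewrite uniq_map IHl /=.
  apply/hasPn => _ /mapP[s _ ->]; case: ifP => // _.
  by apply/mapP => -[t _ []].
Qed.

Lemma size_tails k l n : (size (tails k l n))%:Z = (q ^+ l * delannoy 1 k l) n.
Proof.
elim: k l n => [|k IHk] l n.
  by rewrite delannoy0l /= fps_qXM fps1E subn_eq0; case: (ltngtP n l).
elim: l n => [|l IHl] n; first by rewrite mul1r fps1E /=; case: ifP.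
have -> : q ^+ l.+1 * delannoy 1 k.+1 l.+1 = q ^+ l.+1 * delannoy 1 k l.+1 +
    (q ^+ k.+1 * (q ^+ l * delannoy 1 k l) + q ^+ k.+2 * (q ^+ l * delannoy 1 k.+1 l)).
  by rewrite delannoy_rec !exprS; ring.
rewrite !fpsDE -IHk (fps_qXM k.+1) (fps_qXM k.+2) /= !size_cat !PoszD; congr (_ + (_ + _)).
  by rewrite ltnS; case: ifP => // _; rewrite size_map IHk.
by case: ifP => // _; rewrite size_map -IHl.
Qed.

(** Parts are at most [n], so the restriction on parts equal to [n + 1] is vacuous in the box of
    index [n]. *)
Lemma overpartitionE n s : overpartition n s = in_box n (size s) n s.
Proof.
rewrite /overpartition /in_box eqxx /=; case: eqP => [sn|_]; last by rewrite andbF.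
rewrite /= /parts all_map; congr (_ && _); apply: eq_in_all => x xs /=.
suff xn : (x.1 <= n)%N.
  by rewrite (leqW xn) andbT (ltn_eqF (xn : x.1 < n.+1)%N) implybT andbT.
rewrite -sn; elim: s xs {sn} => //= y s IHs; rewrite in_cons => /orP[/eqP->|/IHs xs].
  exact: leq_addr.
exact: leq_trans xs (leq_addl _ _).
Qed.

Lemma overpartition_cons n p b s : overpartition n ((p, b) :: s) =
  [&& (0 < p)%N, (p <= n)%N & in_box p.-1 (size s) (n - p) s].
Proof.
rewrite overpartitionE in_box_cons; case: (leqP p n) => [pn|]; rewrite ?andbF //=.
by rewrite leqW // (ltn_eqF (pn : p < n.+1)%N) implybT andbT.
Qed.

(** An entry (k, l, b) stands for a first part [k + 1] with flag [b], followed by [l] parts. *)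
Definition shapes n : seq (nat * nat * bool) :=
  [seq (x, b) | x <- [seq (k, l) | k <- iota 0 n, l <- iota 0 n], b <- [:: true; false]].

Definition overpartitions n : seq (seq (nat * bool)) :=
  (if n == 0%N then [:: [::]] else [::]) ++
  [seq (x.1.1.+1, x.2) :: s | x <- shapes n, s <- tails x.1.1 x.1.2 (n - x.1.1.+1)].

Lemma mem_shapes n k l b : ((k, l, b) \in shapes n) = (k < n)%N && (l < n)%N.
Proof.
apply/allpairsP/idP => [[[[k' l'] b'] /= [/allpairsP[[k2 l2] /=]]]|/andP[kn ln]].
  by rewrite !mem_iota !add0n => -[/andP[_ kn] /andP[_ ln] [-> ->]] _ [-> -> _]; rewrite kn.
exists ((k, l), b); split=> //=; last by case: b.
by apply/allpairsP; exists (k, l); rewrite !mem_iota.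
Qed.

Lemma in_box_size k l n s : in_box k l n s -> (l <= n)%N /\ size s = l.
Proof.
case/and5P=> /eqP sl /eqP <- s1 _ _; split=> //; rewrite -sl.
elim: s s1 {sl} => //= x s IHs /andP[/andP[/andP[x0 _] _] /IHs le_s].
exact: leq_add x0 le_s.
Qed.

Lemma mem_overpartitions n s : (s \in overpartitions n) = overpartition n s.
Proof.
rewrite mem_cat; case: s => [|[p b] s].
  rewrite [X in _ || X](_ : _ = false).
    by rewrite orbF; case: n.
  by apply/allpairsPdep => -[x [t [_ _]]].
rewrite [X in X || _](_ : _ = false); last by case: ifP.
rewrite overpartition_cons /=; apply/allpairsPdep/and3P.
  case=> [[[k l] c] [t [/= xn]]]; rewrite mem_tails => tk [-> _ ->].
  have [ln sl] := in_box_size tk; move: xn; rewrite mem_shapes => /andP[kn _].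
  by split=> //=; rewrite sl.
case=> p0 pn sp; have [ln _] := in_box_size sp.
exists (p.-1, size s, b), s; rewrite mem_tails /= prednK // sp.
by split=> //; rewrite mem_shapes; lia.
Qed.

Lemma uniq_overpartitions n : uniq (overpartitions n).
Proof.
rewrite cat_uniq; apply/and3P; split; first by case: ifP.
  apply/hasPn => _ /allpairsPdep[x [t [_ _ ->]]].
  by case: ifP => //=; rewrite inE.
apply: allpairs_uniq_dep => [|x _|].
- apply: allpairs_uniq => //; last by move=> [[k l] b] [[k' l'] b'] _ _ /= [-> -> ->].
  by apply: allpairs_uniq; rewrite ?iota_uniq // => -[k l] [k' l'].
- exact: uniq_tails.
move=> [[[k l] b] s] [[[k' l'] b'] s'] /allpairsPdep[[[k1 l1] b1] [t [_ st E]]].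
move=> /allpairsPdep[[[k2 l2] b2] [t' [_ st' E']]].
move: E st E' st' => [-> -> -> ->] + [-> -> -> ->] + /= [-> -> tt'].
rewrite /= !mem_tails tt' => /in_box_size[_ <-] /in_box_size[_ <-].
by [].
Qed.

(** * Weighted counts by rank *)

Definition total (f : int -> int) n : int := \sum_(s <- overpartitions n) f (rank s).

Lemma Nbar_total a c n :
  (Nbar a c n)%:Z = total (fun x => indic (x == a %[mod c])%Z) n.
Proof.
rewrite /total; have -> : \sum_(s <- overpartitions n) indic (rank s == a %[mod c])%Z =
    (count (fun s => rank s == a %[mod c])%Z (overpartitions n))%:Z.
  by elim: (overpartitions n) => [|s t IHt]; rewrite ?big_nil // big_cons IHt /= PoszD.
rewrite -size_filter /Nbar cardE -(size_map (@decode n)); congr (_%:Z).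
apply/perm_size/uniq_perm.
- by rewrite map_inj_uniq ?enum_uniq //; apply: decode_inj.
- by rewrite filter_uniq // uniq_overpartitions.
move=> s; rewrite mem_filter mem_overpartitions; apply/mapP/andP => [[t]|[rs os]].
  by rewrite mem_enum inE => /andP[ot rt] ->.
by have [t ts] := overpartition_decode os; exists t; rewrite // mem_enum inE ts os.
Qed.

Lemma rank_cons p b s n l : in_box p.-1 l n s -> (0 < p)%N -> rank ((p, b) :: s) = p.-1%:Z - l%:Z.
Proof.
move=> os p0; have [_ sl] := in_box_size os; rewrite /rank /= sl big_cons /=.
suff -> : maxn p (\max_(i <- parts s) i)%N = p by lia.
apply/maxn_idPl; apply/bigmax_leqP_seq => i /mapP[x xs ->] _.
by case/and5P: os => _ _ /allP/(_ x xs)/andP[/andP[_]]; rewrite prednK.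
Qed.

(** For one fixed flag, the overpartitions with first part [k + 1] and [l] further parts, hence of
    rank [k - l]. The exponent joins [k + 1] to the [l] of [size_tails]; the two flags are the
    factor 2 in [total_cells]. *)
Definition cell k l : fps := q ^+ (k + l).+1 * delannoy 1 k l.

(** The source of the symmetry of the rank under negation. *)
Lemma cellC k l : cell k l = cell l k.
Proof. by rewrite /cell delannoyC addnC. Qed.

Lemma total_cells f n : total f n =
  (n == 0%N)%:R * f 0 + 2 * \sum_(k < n) \sum_(l < n) f (k%:Z - l%:Z) * cell k l n.
Proof.
rewrite /total big_cat /=; congr (_ + _).
  case: n => [|n] /=; last by rewrite big_nil mul0r.
  by rewrite big_seq1 mul1r /rank /= big_nil.
rewrite big_allpairs_dep big_allpairs_dep big_allpairs_dep mulr_sumr.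
rewrite -(big_mkord xpredT (fun k => 2 * \sum_(l < n) f (k%:Z - l%:Z) * cell k l n)).
rewrite /index_iota subn0 big_seq [RHS]big_seq; apply: eq_bigr => k; rewrite mem_iota => kn.
rewrite mulr_sumr -(big_mkord xpredT (fun l => 2 * (f (k%:Z - l%:Z) * cell k l n))).
rewrite /index_iota subn0; apply: eq_bigr => l _.
have tE (b : bool) : \sum_(s <- tails k l (n - k.+1)) f (rank ((k.+1, b) :: s)) =
    f (k%:Z - l%:Z) * cell k l n.
  rewrite big_seq (eq_bigr (fun=> f (k%:Z - l%:Z))) => [|s]; last first.
    by rewrite mem_tails => /(@rank_cons k.+1 b) ->.
  rewrite -big_seq big_const_seq count_predT iter_addr_0 -mulr_natr; congr (_ * _).
  rewrite natz size_tails /cell -addSn exprD -mulrA (fps_qXM k.+1).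
  by move: kn; rewrite add0n => /= ->.
by rewrite big_cons big_seq1 !tE mulr2n mulrDl mul1r.
Qed.

Lemma total_swap f n : total (fun x => f (- x)) n = total f n.
Proof.
rewrite !total_cells oppr0 exchange_big; congr (_ + _ * _).
by do 2!(apply: eq_bigr => ? _); rewrite opprB cellC.
Qed.

Lemma total_add f g n : total f n + total g n = total (fun x => f x + g x) n.
Proof. by rewrite /total -big_split. Qed.

Lemma total_opp f n : - total f n = total (fun x => - f x) n.
Proof. by rewrite /total sumrN. Qed.

Lemma eq_total f g n : f =1 g -> total f n = total g n.
Proof. by move=> fg; apply: eq_bigr => s _; apply: fg. Qed.

Lemma mul_qsum_coef (f : fps) g K n : (n < K)%N ->
  (f * qsum g) n = \sum_(b < K) (q ^+ b * (f * g b)) n.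
Proof. by move=> nK; rewrite qsum_mull (qsum_trunc _ nK) fps_sumE. Qed.

(** The cells are folded along [k = l]: by symmetry the two triangles contribute equally, and the
    diagonals of one triangle are the series [diag_sumq 1 m]. The splitting of [chi] into values of
    [eta] matches [diag_sum_rec]. *)
Lemma total_rank_gf (eta chi : int -> int) n : eta 1 = 1 -> chi 0 = 2 ->
  (forall x, chi (- x) = chi x) -> (forall x, 0 < x -> chi x = eta x + eta (x + 1)) ->
  total chi n = 2 * rank_gf eta n.
Proof.
move=> eta1 chi0 chiN chi_eta.
(* The value 1 at [m = 0] is half of [chi 0], since both triangles contain the diagonal. *)
pose xi (m : nat) := if m == 0%N then 1 else chi m%:Z.
have rank_gfE : rank_gf eta = 1 + 2%:~R * (q * qsum (fun m => (xi m)%:~R * diag_sumq 1 m)).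
  rewrite /rank_gf; congr (1 + 2%:~R * (q * _)).
  transitivity (qsum (fun m => (eta m.+1%:Z)%:~R * diag_sumq 1 m) +
                q * qsum (fun m => (eta m.+1%:Z)%:~R * diag_sumq 1 m.+1)).
    rewrite qsum_mull qsumD; apply: eq_qsum => m.
    by rewrite (diag_sum_rec 1 m); ring.
  rewrite qsum_recl [RHS]qsum_recl -addrA -mulrDr qsumD eta1; congr (_ + _ * _).
  by apply: eq_qsum => m; rewrite /xi /= chi_eta // (_ : m.+1%:Z + 1 = m.+2%:Z);
    [ring | lia].
pose G (p : nat * nat) := if (p.2 <= p.1)%N then xi (p.1 - p.2)%N * cell p.1 p.2 n else 0.
have cell0 k l : cell k l n != 0 -> (k < n)%N && (l < n)%N.
  by rewrite /cell fps_qXM; case: ifP; rewrite ?eqxx //; lia.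
have sumG : is_sum G ((q * qsum (fun m => (xi m)%:~R * diag_sumq 1 m)) n).
  apply/(is_sum_bij (J := (nat * nat)%type) _ (h := fun p => (p.2 + p.1, p.2)%N)
    (g := fun p => (p.1 - p.2, p.2)%N)).
  - by move=> [m b] /=; rewrite addKn.
  - by move=> [k l]; rewrite /G /=; case: ifP => [lk _|]; rewrite ?eqxx // subnKC.
  exists [seq (m, b) | m <- iota 0 n.+1, b <- iota 0 n.+1].
    split; first by rewrite allpairs_uniq ?iota_uniq // => -[? ?] [? ?].
    move=> [m b] mb0; apply/allpairsP; exists (m, b); rewrite !mem_iota.
    move: mb0; rewrite /G /= leq_addr mulf_eq0 negb_or => /andP[_ /cell0 mb].
    by split=> //; lia.
  rewrite big_allpairs_dep (mul_qsum_coef _ _ (ltnSn n)).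
  rewrite -(big_mkord xpredT (fun m => (q ^+ m * (q * ((xi m)%:~R * diag_sumq 1 m))) n)).
  rewrite /index_iota subn0; apply: eq_bigr => m _.
  rewrite (_ : q ^+ m * _ = (q ^+ m * q * (xi m)%:~R) * diag_sumq 1 m); last by ring.
  rewrite (mul_qsum_coef _ _ (ltnSn n)).
  rewrite -(big_mkord xpredT (fun b =>
    (q ^+ b * (q ^+ m * q * (xi m)%:~R * (q ^+ b * delannoy 1 (b + m) b))) n)).
  rewrite /index_iota subn0; apply: eq_bigr => b _.
  rewrite /G /= leq_addr addKn -fps_intE /cell; congr (fcoef _ n).
  by rewrite -addnA -addnS -addnS !exprD !exprS; ring.
have sumF : is_sum (fun p : nat * nat => chi (p.1%:Z - p.2%:Z) * cell p.1 p.2 n)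
    (\sum_(k < n) \sum_(l < n) chi (k%:Z - l%:Z) * cell k l n).
  exists [seq (k, l) | k <- iota 0 n, l <- iota 0 n].
    split; first by rewrite allpairs_uniq ?iota_uniq // => -[? ?] [? ?].
    move=> [k l]; rewrite /= mulf_eq0 negb_or => /andP[_ /cell0 /andP[kn ln]].
    by apply/allpairsP; exists (k, l); rewrite !mem_iota.
  rewrite big_allpairs_dep -(big_mkord xpredT
    (fun k => \sum_(l < n) chi (k%:Z - l%:Z) * cell k l n)) /index_iota subn0.
  apply: eq_bigr => k _.
  by rewrite -(big_mkord xpredT (fun l => chi (k%:Z - l%:Z) * cell k l n)) /index_iota subn0.
have swapK : cancel (fun p : nat * nat => (p.2, p.1)) (fun p => (p.2, p.1)) by case.
have sumG' := iffLR (is_sum_bij _ swapK (fun i _ => swapK i)) sumG.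
suff FG : \sum_(k < n) \sum_(l < n) chi (k%:Z - l%:Z) * cell k l n =
    2 * (q * qsum (fun m => (xi m)%:~R * diag_sumq 1 m)) n.
  by rewrite total_cells chi0 FG rank_gfE fpsDE fps1E fps_intE; ring.
apply: is_sum_uniq sumF _; rewrite mulr2n mulrDl mul1r.
apply: eq_is_sum (is_sumD sumG sumG') => -[k l]; rewrite /G /xi /= [cell l k]cellC.
case: (ltngtP k l) => [kl|lk|->].
- by rewrite add0r ifF; [rewrite -chiN; congr (chi _ * _)|]; lia.
- by rewrite addr0 ifF; [congr (chi _ * _)|]; lia.
- by rewrite subnn subrr chi0 /=; ring.
Qed.

Definition twocos3 (x : int) : int := eta3 x + eta3 (x + 1).
Definition twocos6 (x : int) : int := eta6 x + eta6 (x + 1).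

Lemma twocos3N x : twocos3 (- x) = twocos3 x.
Proof.
have [k [r [r3 ->]]] := modz_cases x (isT : (0 < 3)%N).
have [E1 E2 E3 E4] := modz_period k 3%N r 1.
rewrite /twocos3 /eta3 ?E1 ?E2 ?E3 ?E4 {E1 E2 E3 E4}.
by case: r r3 => [|[|[|]]].
Qed.

Lemma twocos6N x : twocos6 (- x) = twocos6 x.
Proof.
have [k [r [r6 ->]]] := modz_cases x (isT : (0 < 6)%N).
have [E1 E2 E3 E4] := modz_period k 6%N r 1.
rewrite /twocos6 /eta6 ?E1 ?E2 ?E3 ?E4 {E1 E2 E3 E4}.
by case: r r6 => [|[|[|[|[|[|]]]]]].
Qed.

Lemma Nbar_rank_gf3 n : (Nbar 0 3 n)%:Z - (Nbar 1 3 n)%:Z = rank_gf eta3 n.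
Proof.
suff : 2 * ((Nbar 0 3 n)%:Z - (Nbar 1 3 n)%:Z) = 2 * rank_gf eta3 n by lia.
rewrite -(total_rank_gf (chi := twocos3)) //; last exact: twocos3N.
(* One of the two copies is taken at the negated rank; the indicators, thus symmetrized, add up to
   [twocos3]. *)
rewrite !Nbar_total total_opp total_add mulr2n mulrDl mul1r -{2}total_swap total_add.
apply: eq_total => x; have [k [r [r3 ->]]] := modz_cases x (isT : (0 < 3)%N).
have [E1 E2 E3 E4] := modz_period k 3%N r 1.
rewrite /twocos3 /eta3 ?E1 ?E2 ?E3 ?E4 {E1 E2 E3 E4}.
by case: r r3 => [|[|[|]]].
Qed.

Lemma Nbar_rank_gf6 n : (Nbar 0 6 n)%:Z + (Nbar 1 6 n)%:Z - (Nbar 2 6 n)%:Z - (Nbar 3 6 n)%:Z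
  = rank_gf eta6 n.
Proof.
suff : 2 * ((Nbar 0 6 n)%:Z + (Nbar 1 6 n)%:Z - (Nbar 2 6 n)%:Z - (Nbar 3 6 n)%:Z)
    = 2 * rank_gf eta6 n by lia.
rewrite -(total_rank_gf (chi := twocos6)) //; last exact: twocos6N.
rewrite !Nbar_total !total_opp !total_add mulr2n mulrDl mul1r -{2}total_swap total_add.
apply: eq_total => x; have [k [r [r6 ->]]] := modz_cases x (isT : (0 < 6)%N).
have [E1 E2 E3 E4] := modz_period k 6%N r 1.
rewrite /twocos6 /eta6 ?E1 ?E2 ?E3 ?E4 {E1 E2 E3 E4}.
by case: r r6 => [|[|[|[|[|[|]]]]]].
Qed.

Lemma Nbar_1_3 n : Nbar 1 3 n = Nbar 2 3 n.
Proof.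
apply/eqP; rewrite -eqz_nat !Nbar_total -total_swap; apply/eqP/eq_total => x.
by rewrite /indic; lia.
Qed.

Lemma Nbar_03_6 n : (Nbar 0 6 n + Nbar 3 6 n)%N = Nbar 0 3 n.
Proof.
apply/eqP; rewrite -eqz_nat PoszD !Nbar_total total_add; apply/eqP/eq_total => x.
by rewrite /indic; lia.
Qed.

Lemma Nbar_12_6 n : (Nbar 1 6 n + Nbar 2 6 n)%N = Nbar 1 3 n.
Proof.
(* Negation moves the class 2 modulo 6 to the class 4, which together with the class 1 makes up the
   class 1 modulo 3. *)
apply/eqP; rewrite -eqz_nat PoszD !Nbar_total -[in X in _ + X]total_swap total_add.
by apply/eqP/eq_total => x; rewrite /indic; lia.
Qed.

Local Close Scope ring_scope.

Theorem theorem3 (n : nat) :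
  (Nbar 0 6 n + Nbar 1 6 n >= Nbar 2 6 n + Nbar 3 6 n)
  /\ (Nbar 0 6 (3 * n) + Nbar 3 6 (3 * n)
        >= Nbar 1 6 (3 * n) + Nbar 2 6 (3 * n))
  /\ (Nbar 0 6 (3 * n + 1) + Nbar 3 6 (3 * n + 1)
        >= Nbar 1 6 (3 * n + 1) + Nbar 2 6 (3 * n + 1))
  /\ (Nbar 0 6 (3 * n + 2) + Nbar 3 6 (3 * n + 2)
        <= Nbar 1 6 (3 * n + 2) + Nbar 2 6 (3 * n + 2))
  /\ (Nbar 0 3 (3 * n) >= Nbar 1 3 (3 * n)
        /\ Nbar 1 3 (3 * n) = Nbar 2 3 (3 * n))
  /\ (Nbar 0 3 (3 * n + 1) >= Nbar 1 3 (3 * n + 1)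
        /\ Nbar 1 3 (3 * n + 1) = Nbar 2 3 (3 * n + 1))
  /\ (Nbar 0 3 (3 * n + 2) <= Nbar 1 3 (3 * n + 2)
        /\ Nbar 1 3 (3 * n + 2) = Nbar 2 3 (3 * n + 2)).
Proof.
(* Merging classes turns the claims modulo 6 on arithmetic progressions into those modulo 3; what
   remains are the signs of the two rank series. *)
rewrite !Nbar_03_6 !Nbar_12_6 -!Nbar_1_3.
have := rank_gf6_ge0 n; rewrite -Nbar_rank_gf6.
have := @rank_gf3_ge0 0 n isT; rewrite addn0 -Nbar_rank_gf3.
have := @rank_gf3_ge0 1 n isT; rewrite -Nbar_rank_gf3.
have := rank_gf3_le0 n; rewrite -Nbar_rank_gf3.
by lia.
Qed.
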